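(* Let $\phi\colon\mathbb{D}\to\mathbb{D}$ be an analytic self-map. There exists $w\in H^2$ such that the weighted composition operator $M_wC_\phi\colon f\mapsto w\,(f\circ\phi)$ is bounded but not compact on $H^2$ if and only if $\|\phi\|_\infty=\sup_{z\in\mathbb{D}}|\phi(z)|=1$.
   Context: $\mathbb{D}$ is the open unit disk and $H^2$ the Hardy space of $\mathbb{D}$. *)

(* Defs.v *)
From HB Require Import structures.
From mathcomp Require Import all_boot all_order all_algebra.
From mathcomp Require Import complex.
From mathcomp Require Import all_classical all_reals all_analysis.
Import Order.TTheory GRing.Theory Num.Theory numFieldNormedType.Exports.

Set Implicit Arguments.
Unset Strict Implicit.
Unset Printing Implicit Defensive.

Local Open Scope classical_set_scope.
Local Open Scope ring_scope.

Definition Cx (R : realType) : numClosedFieldType := R[i].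
(* (Cx R) carries the standard (norm) topology of a numFieldType. *)
Definition cmod (R : realType) (z : (Cx R)) : R := ComplexField.Normc.normc z.

Definition disk (R : realType) : set (Cx R) := [set z | cmod z < 1].

Definition pseries_to (R : realType) (a : nat -> (Cx R)) (z v : (Cx R)) : Prop :=
  series (fun n => a n * z ^+ n) @ \oo --> v.

Definition peval (R : realType) (a : nat -> (Cx R)) (z : (Cx R)) : (Cx R) :=
  lim (series (fun n => a n * z ^+ n) @ \oo).

(* f : C -> C is analytic on the disk: it is given on the disk by a
   power series centered at 0 (equivalent to holomorphy on the disk). *)
Definition analytic_on_disk (R : realType) (f : (Cx R) -> (Cx R)) : Prop :=
  exists a : nat -> (Cx R), forall z, disk z -> pseries_to a z (f z).

Definition analytic_selfmap (R : realType) (phi : (Cx R) -> (Cx R)) : Prop :=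
  analytic_on_disk phi /\ forall z, disk z -> disk (phi z).

(* Hardy space H^2, via Taylor coefficients: a is the coefficient sequence of
   an H^2 function iff sum |a_n|^2 < oo; the function is z |-> peval a z on
   the disk and its norm is (sum |a_n|^2)^(1/2). *)
Definition in_H2 (R : realType) (a : nat -> (Cx R)) : Prop :=
  cvg (series (fun n => cmod (a n) ^+ 2) @ \oo).

Definition H2norm (R : realType) (a : nat -> (Cx R)) : R :=
  Num.sqrt (lim (series (fun n => cmod (a n) ^+ 2) @ \oo)).

Definition wcomp_maps (R : realType) (w phi : (Cx R) -> (Cx R)) (a b : nat -> (Cx R))
  : Prop :=
  in_H2 b /\ forall z, disk z -> peval b z = w z * peval a (phi z).

Definition wcomp_bounded (R : realType) (w phi : (Cx R) -> (Cx R)) : Prop :=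
  exists M : R, forall a, in_H2 a ->
    exists b, wcomp_maps w phi a b /\ H2norm b <= M * H2norm a.

Definition wcomp_compact (R : realType) (w phi : (Cx R) -> (Cx R)) : Prop :=
  forall A : nat -> nat -> (Cx R),
    (forall k, in_H2 (A k)) -> (forall k, H2norm (A k) <= 1) ->
    exists (s : nat -> nat) (B : nat -> nat -> (Cx R)) (c : nat -> (Cx R)),
      [/\ (forall k, (s k < s k.+1)%N),
          (forall k, wcomp_maps w phi (A (s k)) (B k)),
          in_H2 c &
          (fun k => H2norm (fun n => B k n - c n)) @ \oo --> (0 : R)].

Definition sup_norm_disk (R : realType) (phi : (Cx R) -> (Cx R)) : R :=
  sup [set cmod (phi z) | z in disk (R:=R)].

(* Main.v *)
Require Import Defs.
From HB Require Import structures.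
From mathcomp Require Import all_boot all_order all_algebra.
From mathcomp Require Import cyclic separable cyclotomic.
From mathcomp Require Import complex.
From mathcomp Require Import all_classical all_reals all_analysis.
From mathcomp Require Import ring lra.
Import Order.TTheory GRing.Theory Num.Theory numFieldNormedType.Exports.
Set Implicit Arguments.
Unset Strict Implicit.
Unset Printing Implicit Defensive.
Local Open Scope classical_set_scope.
Local Open Scope ring_scope.

(** Write [T_w f = w (f o phi)], and let [k_p] be the normalized reproducing kernel at [p].

    If [|phi| <= r < 1], a bounded sequence of H^2 has a subsequence [f_k] converging
    to some [f] uniformly on [|z| <= r], and [|T_w (f_k - f)|] is at most the supremum of
    [|f_k - f|] on that disk times the norm of [w]; so every [T_w] is compact.

    If [phi] has supremum 1, put [l = phi p], [delta = sqrt (1 - |l|^2)] and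
    [w_p = delta k_p].  Conjugating by disk automorphisms reduces [T_(w_p)] to composition
    with a map fixing 0, which is a contraction by Littlewood's argument; this gives
    [|T_(w_p)| <= 2] for all p, while [|w_p| <= delta] in H^2 and [T_(w_p) k_l] has norm at
    least 1.  Suppose that all bounded [T_w] are compact.  For compact [T_W] and
    [delta -> 0], the operators [T_W] and [T_(w_p)] become almost orthogonal on both sides,
    hence the norm of [T_(W + w_p)] is almost [max (|T_W|, 2)].  Iterating, one gets points
    [p_j] such that [w = sum_j w_(p_j)] has [|T_w| <= 3] although
    [|w (p_j)| sqrt (1 - |p_j|^2) >= 3/4 delta_j], which contradicts compactness. *)

(** * The complex modulus and convergence of complex sequences *)

Section Modulus.
Variable R : realType.
Local Notation C := (Cx R).
Implicit Types (x y : R) (z w : C).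

Definition cof (x : R) : C := (x%:C)%C.

Lemma cmod_norm z : `|z| = cof (cmod z).
Proof. by rewrite normc_def; case: z. Qed.

Lemma cof_inj : injective cof.
Proof. by move=> x y [->]. Qed.

Lemma cofM x y : cof (x * y) = cof x * cof y.
Proof. exact: (rmorphM (real_complex R)). Qed.

Lemma cofD x y : cof (x + y) = cof x + cof y.
Proof. exact: (rmorphD (real_complex R)). Qed.

Lemma cofB x y : cof (x - y) = cof x - cof y.
Proof. exact: (rmorphB (real_complex R)). Qed.

Lemma cofV x : cof x^-1 = (cof x)^-1.
Proof. exact: (fmorphV (real_complex R)). Qed.

Lemma cof1 : cof 1 = 1. Proof. by []. Qed.

Lemma cof0 : cof 0 = 0. Proof. by []. Qed.

Lemma cofX x n : cof (x ^+ n) = cof x ^+ n.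
Proof. exact: (rmorphXn (real_complex R)). Qed.

Lemma le_cof x y : (cof x <= cof y) = (x <= y).
Proof. by rewrite lecE /= eqxx. Qed.

Lemma lt_cof x y : (cof x < cof y) = (x < y).
Proof. by rewrite ltcE /= eqxx. Qed.

Lemma cmod_ge0 z : 0 <= cmod z.
Proof. by case: z => a b; exact: sqrtr_ge0. Qed.

Lemma cmodM z w : cmod (z * w) = cmod z * cmod w.
Proof. exact: ComplexField.Normc.normcM. Qed.

Lemma cmod0 : cmod (0 : C) = 0.
Proof. exact: ComplexField.Normc.normc0. Qed.

Lemma cmod1 : cmod (1 : C) = 1.
Proof. exact: ComplexField.Normc.normc1. Qed.

Lemma cmodN z : cmod (- z) = cmod z.
Proof. exact: normcN. Qed.

Lemma cmodB z w : cmod (z - w) = cmod (w - z).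
Proof. by rewrite -cmodN opprB. Qed.

Lemma cmodV z : cmod z^-1 = (cmod z)^-1.
Proof. exact: ComplexField.Normc.normcV. Qed.

Lemma cmodD z w : cmod (z + w) <= cmod z + cmod w.
Proof. exact: le_normcD. Qed.

Lemma cmod_eq0 z : cmod z = 0 -> z = 0.
Proof. exact: ComplexField.Normc.eq0_normc. Qed.

Lemma cmodX z n : cmod (z ^+ n) = cmod z ^+ n.
Proof. by elim: n => [|n IH]; rewrite ?expr0 ?cmod1 // !exprS cmodM IH. Qed.

Lemma cmod_cof x : 0 <= x -> cmod (cof x) = x.
Proof. by move=> x0; rewrite /cmod /= expr0n /= addr0 sqrtr_sqr ger0_norm. Qed.

Lemma cmod_sq z : cmod z ^+ 2 = complex.Re z ^+ 2 + complex.Im z ^+ 2.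
Proof. by case: z => a b; rewrite /cmod /= sqr_sqrtr // addr_ge0 ?sqr_ge0. Qed.

Lemma mulC_conj z : z * z^* = cof (cmod z ^+ 2).
Proof. by rewrite -normCK cmod_norm cofX. Qed.

Lemma cmod_conj z : cmod z^* = cmod z.
Proof. by apply: cof_inj; rewrite -!cmod_norm norm_conjC. Qed.

Lemma cmod_sum (I : Type) (r : seq I) (P : pred I) (F : I -> C) :
  cmod (\sum_(i <- r | P i) F i) <= \sum_(i <- r | P i) cmod (F i).
Proof.
elim/big_ind2: _ => [|x1 x2 y1 y2 h1 h2|//]; first by rewrite cmod0.
exact: le_trans (cmodD _ _) (lerD h1 h2).
Qed.

Lemma cmod_triB z w : cmod z <= cmod w + cmod (z - w).
Proof. by have := cmodD w (z - w); rewrite [_ + (_ - _)]addrC subrK. Qed.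

Lemma le_cmod_Re z : `|complex.Re z| <= cmod z.
Proof. by have := normc_ge_Re z; rewrite cmod_norm le_cof. Qed.

Lemma le_cmod_Im z : `|complex.Im z| <= cmod z.
Proof.
rewrite -(ler_pXn2r (n := 2)) ?nnegrE ?cmod_ge0 //.
by rewrite cmod_sq real_normK ?num_real // lerDr sqr_ge0.
Qed.

Lemma cmod_le_ReIm z : cmod z <= `|complex.Re z| + `|complex.Im z|.
Proof.
rewrite -(ler_pXn2r (n := 2)) ?nnegrE ?cmod_ge0 ?addr_ge0 //.
rewrite cmod_sq -[complex.Re z ^+ 2]real_normK ?num_real //.
rewrite -[complex.Im z ^+ 2]real_normK ?num_real //.
have : 0 <= `|complex.Re z| * `|complex.Im z| by rewrite mulr_ge0.
nra.
Qed.

Lemma cmod_sqD z w :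
  cmod (z + w) ^+ 2 = cmod z ^+ 2 + cmod w ^+ 2 + 2 * complex.Re (z * w^*).
Proof. by case: z w => a b [c d]; rewrite !cmod_sq /=; ring. Qed.

Lemma ReD z w : complex.Re (z + w) = complex.Re z + complex.Re w.
Proof. by case: z w => ? ? []. Qed.

Lemma ImD z w : complex.Im (z + w) = complex.Im z + complex.Im w.
Proof. by case: z w => ? ? []. Qed.

Lemma Re_sum (I : Type) (r : seq I) (P : pred I) (F : I -> C) :
  complex.Re (\sum_(i <- r | P i) F i) = \sum_(i <- r | P i) complex.Re (F i).
Proof. exact: (big_morph _ ReD). Qed.

Lemma Im_sum (I : Type) (r : seq I) (P : pred I) (F : I -> C) :
  complex.Im (\sum_(i <- r | P i) F i) = \sum_(i <- r | P i) complex.Im (F i).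
Proof. exact: (big_morph _ ImD). Qed.

(** Convergence in the topology of [Cx R], with a real radius so that all estimates stay among real
    numbers. *)
Definition cvC (u : nat -> C) (l : C) :=
  forall e : R, 0 < e -> exists N, forall n, (N <= n)%N -> cmod (u n - l) < e.

Lemma cvCP (u : nat -> C) (l : C) : (u @ \oo --> l) <-> cvC u l.
Proof.
split=> [/cvgrPdist_lt h e e0|h].
  have /h [N _ hN] : 0 < cof e by rewrite -cof0 lt_cof.
  by exists N => n /hN; rewrite cmodB cmod_norm lt_cof.
apply/cvgrPdist_lt => e e0; move: (e0); rewrite ltcE => /andP[/= /eqP ei er].
have [N hN] := h _ er; exists N => // n /hN.
rewrite cmodB -lt_cof -cmod_norm => /lt_le_trans; apply.
by rewrite lecE /= ei eqxx lexx.
Qed.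

Lemma cvC_uniq (u : nat -> C) (l l' : C) : cvC u l -> cvC u l' -> l = l'.
Proof.
move=> h h'; apply/eqP; rewrite -subr_eq0; apply/eqP/cmod_eq0/eqP.
rewrite eq_le cmod_ge0 andbT; apply/ler_addgt0Pl => e e0.
have e2 : 0 < e / 2 by lra.
have [N hN] := h _ e2; have [N' hN'] := h' _ e2.
have /ltW h1 := hN _ (leq_maxl N N'); have /ltW h2 := hN' _ (leq_maxr N N').
have := cmodD (l - u (maxn N N')) (u (maxn N N') - l').
rewrite cmodB in h1; rewrite addrA subrK => h3; lra.
Qed.

Lemma cvC_cst (l : C) : cvC (fun=> l) l.
Proof. by move=> e e0; exists 0%N => n _; rewrite subrr cmod0. Qed.

Lemma cvC_ext (u v : nat -> C) l : u =1 v -> cvC u l -> cvC v l.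
Proof. by move=> h; rewrite (funext h). Qed.

Lemma cvCD (u v : nat -> C) l l' :
  cvC u l -> cvC v l' -> cvC (fun n => u n + v n) (l + l').
Proof.
move=> h h' e e0; have e2 : 0 < e / 2 by lra.
have [N hN] := h _ e2; have [N' hN'] := h' _ e2.
exists (maxn N N') => n; rewrite geq_max => /andP[/hN h1 /hN' h2].
have := cmodD (u n - l) (v n - l').
by rewrite opprD addrACA => h3; lra.
Qed.

Lemma cvCZ (c : C) (u : nat -> C) l : cvC u l -> cvC (fun n => c * u n) (c * l).
Proof.
move=> h e e0; have c0 : 0 < cmod c + 1 by have := cmod_ge0 c; lra.
have [N hN] := h _ (divr_gt0 e0 c0).
exists N => n /hN; rewrite -mulrBr cmodM ltr_pdivlMr // => h1.
have := cmod_ge0 (u n - l); have := cmod_ge0 c; nra.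
Qed.

Lemma cvCB (u v : nat -> C) l l' :
  cvC u l -> cvC v l' -> cvC (fun n => u n - v n) (l - l').
Proof.
move=> h /(cvCZ (-1)) h'; have := cvCD h h'; rewrite mulN1r.
by apply: cvC_ext => n; rewrite mulN1r.
Qed.

Lemma cvC_conj (u : nat -> C) l : cvC u l -> cvC (fun n => (u n)^*) l^*.
Proof.
move=> h e /h[N hN]; exists N => n /hN; by rewrite -rmorphB cmod_conj.
Qed.

Lemma cvC_le (u : nat -> C) l (M : R) N :
  cvC u l -> (forall n, (N <= n)%N -> cmod (u n) <= M) -> cmod l <= M.
Proof.
move=> h hM; apply/ler_addgt0Pl => e /h[N' hN'].
have h1 := hN' _ (leq_maxr N N'); have h2 := hM _ (leq_maxl N N').
have := cmod_triB l (u (maxn N N')); rewrite cmodB; lra.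
Qed.

Lemma cvC_sub (u : nat -> C) l (s : nat -> nat) :
  (forall k, (k <= s k)%N) -> cvC u l -> cvC (fun k => u (s k)) l.
Proof.
move=> hs h e /h[N hN]; exists N => n Nn; apply: hN; exact: leq_trans (hs n).
Qed.

Lemma cvC_complex (u : nat -> C) :
  cvgn (fun n => complex.Re (u n)) -> cvgn (fun n => complex.Im (u n)) ->
  exists l, cvC u l.
Proof.
set a := limn (fun n => complex.Re (u n)); set b := limn (fun n => complex.Im (u n)).
move=> /cvgrPdist_lt ha /cvgrPdist_lt hb; exists (Complex a b) => e e0.
have e2 : 0 < e / 2 by lra.
have [N _ hN] := ha _ e2; have [N' _ hN'] := hb _ e2.
exists (maxn N N') => n; rewrite geq_max => /andP[/hN h1 /hN' h2].
have := cmod_le_ReIm (u n - Complex a b).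
move: h1 h2; rewrite distrC -/a [`|limn _ - _|]distrC -/b.
by case: (u n) => c d /=; lra.
Qed.

End Modulus.

(** * Square-summable coefficients and evaluation of power series *)

Section SquareSummable.
Variable R : realType.
Local Notation C := (Cx R).
Implicit Types (a b : nat -> C) (z : C) (M : R).

Lemma geo_sum_le (x : R) N : 0 <= x < 1 -> \sum_(i < N) x ^+ i <= (1 - x)^-1.
Proof.
case/andP=> x0 x1; rewrite -[leRHS]mul1r ler_pdivlMr ?subr_gt0 //.
have h := subrX1 x N.
have : 0 <= x ^+ N by exact: exprn_ge0.
by move: h; set S := \sum_(i < N) _; nra.
Qed.

Lemma exprn_small (x e : R) : 0 <= x < 1 -> 0 < e ->
  exists N, forall n, (N <= n)%N -> x ^+ n < e.
Proof.
case/andP=> x0 x1 e0; have := @cvg_expr R x; rewrite ger0_norm // => /(_ x1).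
move=> /cvgrPdist_lt/(_ _ e0)[N _ hN]; exists N => n /hN.
by rewrite sub0r normrN ger0_norm // exprn_ge0.
Qed.

Lemma sum_cauchy_schwarz N (x y : nat -> R) :
  (\sum_(i < N) x i * y i) ^+ 2 <=
  (\sum_(i < N) x i ^+ 2) * (\sum_(i < N) y i ^+ 2).
Proof.
elim: N => [|N]; first by rewrite !big_ord0 expr0n mul0r.
rewrite !big_ord_recr /=.
have : 0 <= \sum_(i < N) x i ^+ 2 by apply: sumr_ge0 => i _; exact: sqr_ge0.
have : 0 <= \sum_(i < N) y i ^+ 2 by apply: sumr_ge0 => i _; exact: sqr_ge0.
move: (\sum_(i < N) x i ^+ 2) (\sum_(i < N) y i ^+ 2) => A B.
move: (\sum_(i < N) _) (x N) (y N) => S u v B0 A0 SAB.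
(* This follows from [S^2 <= A B] and [(A v^2 - B u^2)^2 >= 0] after squaring. *)
suff : 2 * (S * u * v) <= A * v ^+ 2 + B * u ^+ 2 by nra.
apply: le_trans (ler_norm _) _.
have D0 : 0 <= A * v ^+ 2 + B * u ^+ 2.
  by apply: addr_ge0; apply: mulr_ge0 => //; exact: sqr_ge0.
rewrite -(ler_pXn2r (n := 2)) ?nnegrE // real_normK ?num_real //.
have : 0 <= (u * v) ^+ 2 * (A * B - S ^+ 2).
  by rewrite mulr_ge0 ?sqr_ge0 ?subr_ge0.
have : 0 <= (A * v ^+ 2 - B * u ^+ 2) ^+ 2 by exact: sqr_ge0.
lra.
Qed.

Lemma sum_mul_le N (x y : nat -> R) (X Y : R) : 0 <= X -> 0 <= Y ->
  \sum_(i < N) x i ^+ 2 <= X ^+ 2 -> \sum_(i < N) y i ^+ 2 <= Y ^+ 2 ->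
  \sum_(i < N) x i * y i <= X * Y.
Proof.
move=> X0 Y0 hX hY; apply: le_trans (ler_norm _) _.
rewrite -(ler_pXn2r (n := 2)) ?nnegrE ?mulr_ge0 // real_normK ?num_real //.
apply: le_trans (sum_cauchy_schwarz _ _ _) _; rewrite exprMn.
by apply: ler_pM => //; apply: sumr_ge0 => i _; exact: sqr_ge0.
Qed.

(** Membership in H^2 and a norm bound in one predicate on partial sums, so that neither limits nor
    square roots enter the estimates. *)
Definition l2le a M := 0 <= M /\ forall N, \sum_(i < N) cmod (a i) ^+ 2 <= M ^+ 2.

Lemma l2le_in_H2 a M : l2le a M -> in_H2 a /\ H2norm a <= M.
Proof.
move=> [M0 h].
have nd : nondecreasing_seq (series (fun n => cmod (a n) ^+ 2)).
  by apply: nondecreasing_series => n _ _; exact: sqr_ge0.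
have c : in_H2 a.
  apply: nondecreasing_is_cvgn => //; exists (M ^+ 2) => _ [N _ <-].
  by rewrite /series /= big_mkord.
split=> //; rewrite /H2norm -[M]ger0_norm // -sqrtr_sqr; apply: ler_wsqrtr.
by apply: limr_le => //; near=> N; rewrite /series /= big_mkord.
Unshelve. all: end_near. Qed.

Lemma in_H2_bd a : in_H2 a -> l2le a (H2norm a).
Proof.
move=> h; split=> [|N]; first exact: sqrtr_ge0.
have nd : nondecreasing_seq (series (fun n => cmod (a n) ^+ 2)).
  by apply: nondecreasing_series => n _ _; exact: sqr_ge0.
have le N' := nondecreasing_cvgn_le nd h N'.
have := le 0%N; rewrite /series /= big_nil => l0.
by rewrite sqr_sqrtr //; have := le N; rewrite /series /= big_mkord.
Qed.

Lemma l2le_ge0 a M : l2le a M -> 0 <= M. Proof. by case. Qed.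

Lemma l2le_le a M M' : M <= M' -> l2le a M -> l2le a M'.
Proof.
move=> h [M0 hM]; split=> [|N]; first exact: le_trans h.
by apply: le_trans (hM N) _; rewrite ler_pXn2r ?nnegrE //; exact: le_trans h.
Qed.

Lemma l2le_sqrt a M : (forall N, \sum_(i < N) cmod (a i) ^+ 2 <= M) ->
  l2le a (Num.sqrt M).
Proof.
move=> h; have M0 : 0 <= M by have := h 0%N; rewrite big_ord0.
by split=> [|N]; rewrite ?sqrtr_ge0 ?sqr_sqrtr.
Qed.

Lemma l2leD a b M M' : l2le a M -> l2le b M' -> l2le (fun n => a n + b n) (M + M').
Proof.
move=> [M0 hM] [M0' hM']; split=> [|N]; first exact: addr_ge0.
have h1 := sum_mul_le (x := fun i => cmod (a i)) (y := fun i => cmod (b i))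
  M0 M0' (hM N) (hM' N).
apply: le_trans (_ : \sum_(i < N) (cmod (a i) + cmod (b i)) ^+ 2 <= _).
  apply: ler_sum => i _; rewrite ler_pXn2r ?nnegrE ?addr_ge0 ?cmod_ge0 //.
  exact: cmodD.
rewrite (eq_bigr (fun i : 'I_N => cmod (a i) ^+ 2 + 2 * (cmod (a i) * cmod (b i))
   + cmod (b i) ^+ 2)); last by move=> i _; ring.
rewrite !big_split /= -mulr_sumr; have := hM N; have := hM' N; nra.
Qed.

Lemma l2leZ (c : C) a M : l2le a M -> l2le (fun n => c * a n) (cmod c * M).
Proof.
move=> [M0 hM]; split=> [|N]; first by rewrite mulr_ge0 ?cmod_ge0.
under eq_bigr do rewrite cmodM exprMn.
by rewrite -mulr_sumr exprMn ler_wpM2l ?sqr_ge0.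
Qed.

Lemma l2le0 : l2le (fun=> 0) 0.
Proof.
split=> // N; rewrite big1 ?expr0n // => i _.
by rewrite cmod0 expr0n.
Qed.

Lemma l2le_coef a M n : l2le a M -> cmod (a n) <= M.
Proof.
move=> [M0 hM]; rewrite -(ler_pXn2r (n := 2)) ?nnegrE ?cmod_ge0 //.
apply: le_trans (hM n.+1); rewrite big_ord_recr /= lerDr.
by apply: sumr_ge0 => i _; exact: sqr_ge0.
Qed.

(** Lower semicontinuity of the norm: each partial sum involves finitely many coefficients and
    passes to the limit. *)
Lemma l2le_cv (A : nat -> nat -> C) a M :
  (forall k, l2le (A k) M) -> (forall n, cvC (fun k => A k n) (a n)) -> l2le a M.
Proof.
move=> hA ha; have M0 := l2le_ge0 (hA 0%N); split=> // N.
apply/ler_addgt0Pl => e e0.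
(* Moving each coefficient by at most t <= 1 adds at most N (2 M + 2) t to the sum. *)
have ha' n : forall t : R, 0 < t ->
    exists K, forall k, (K <= k)%N -> cmod (A k n - a n) < t by exact: ha.
have D0 : 0 < N%:R * (2 * M + 2) + 1.
  have : 0 <= N%:R * (2 * M + 2) by rewrite mulr_ge0 //; lra.
  lra.
pose t := Num.min 1 (e / (N%:R * (2 * M + 2) + 1)).
have t0 : 0 < t by rewrite lt_min ltr01 divr_gt0.
have t1 : t <= 1 by rewrite ge_min lexx.
have te : N%:R * (2 * M + 2) * t <= e.
  have : t <= e / (N%:R * (2 * M + 2) + 1) by rewrite ge_min lexx orbT.
  rewrite ler_pdivlMr // => h; apply: le_trans h; nra.
have [k hk] : exists k, forall i, (i < N)%N -> cmod (A k i - a i) < t.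
  have [K hK] := choice (fun n => ha' n t t0).
  exists (\max_(i < N) K i) => i iN; apply: hK.
  exact: (@leq_bigmax _ (fun i : 'I_N => K i) (Ordinal iN)).
have h := (hA k).2 N.
apply: le_trans (_ : \sum_(i < N) (cmod (A k i) ^+ 2 + (2 * M + 2) * t) <= _).
  apply: ler_sum => i _; have h1 := hk i (ltn_ord i).
  have h2 := cmod_triB (a i) (A k i); rewrite cmodB in h2.
  have h3 := l2le_coef i (hA k).
  have h4 := cmod_ge0 (a i); have h5 := cmod_ge0 (A k i).
  have h6 : cmod (a i) <= cmod (A k i) + t by lra.
  have h7 : cmod (a i) ^+ 2 <= (cmod (A k i) + t) ^+ 2.
    by rewrite ler_pXn2r ?nnegrE //; lra.
  apply: le_trans h7 _; nra.
rewrite big_split /= sumr_const card_ord -[_ *+ N]mulr_natl mulrA; lra.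
Qed.

Definition psum a z N : C := \sum_(i < N) a i * z ^+ i.

Lemma pseries_toP a z v : pseries_to a z v <-> cvC (psum a z) v.
Proof.
rewrite -cvCP /pseries_to.
suff -> : series (fun n => a n * z ^+ n) = psum a z by [].
by apply/funext => N; rewrite /series /= big_mkord.
Qed.

Lemma peval_cv a z v : cvC (psum a z) v -> peval a z = v.
Proof. by move/pseries_toP; apply: cvg_lim; exact: norm_hausdorff. Qed.

(** Real and imaginary parts converge absolutely, dominated by a geometric series of ratio
    [cmod z]. *)
Lemma cvC_ps a z M : (forall n, cmod (a n) <= M) -> cmod z < 1 ->
  cvC (psum a z) (peval a z).
Proof.
move=> hM z1; have M0 : 0 <= M := le_trans (cmod_ge0 _) (hM 0%N).
suff [l hl] : exists l, cvC (psum a z) l by rewrite (peval_cv hl).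
have geo : cvgn (series (geometric M (cmod z))).
  by apply: is_cvg_geometric_series; rewrite ger0_norm ?cmod_ge0.
have bnd n : cmod (a n * z ^+ n) <= geometric M (cmod z) n.
  by rewrite /geometric /= cmodM cmodX ler_wpM2r ?exprn_ge0 ?cmod_ge0.
have gge n : 0 <= geometric M (cmod z) n.
  exact: le_trans (cmod_ge0 _) (bnd n).
have main (f : C -> R) : (forall x, `|f x| <= cmod x) ->
    cvgn (series (fun n => f (a n * z ^+ n))).
  move=> hf; apply: normed_cvg.
  apply: (series_le_cvg _ gge) geo => n; first exact: normr_ge0.
  exact: le_trans (hf _) (bnd n).
have eRe : (fun n => complex.Re (psum a z n)) =
    series (fun n => complex.Re (a n * z ^+ n)).
  by apply/funext => N; rewrite /series /= Re_sum big_mkord.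
have eIm : (fun n => complex.Im (psum a z n)) =
    series (fun n => complex.Im (a n * z ^+ n)).
  by apply/funext => N; rewrite /series /= Im_sum big_mkord.
apply: cvC_complex; rewrite ?eRe ?eIm; apply: main.
  exact: le_cmod_Re.
exact: le_cmod_Im.
Qed.

Lemma l2le_cv_ps a z M : l2le a M -> cmod z < 1 -> cvC (psum a z) (peval a z).
Proof. by move=> h; apply: (cvC_ps (M := M)) => n; exact: l2le_coef h. Qed.

Lemma peval_tail_le a z M N : (forall n, cmod (a n) <= M) ->
  (forall n, (n < N)%N -> a n = 0) -> cmod z < 1 ->
  cmod (peval a z) <= M * cmod z ^+ N / (1 - cmod z).
Proof.
move=> hM h0 z1; have M0 : 0 <= M := le_trans (cmod_ge0 _) (hM 0%N).
apply: (cvC_le (N := N) (cvC_ps hM z1)) => n Nn.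
apply: le_trans (cmod_sum _ _ _) _.
rewrite -(subnKC Nn) big_split_ord /= big1 ?add0r; last first.
  by move=> i _; rewrite h0 ?ltn_ord // mul0r cmod0.
apply: le_trans (_ : \sum_(i < n - N) M * cmod z ^+ N * cmod z ^+ i <= _).
  apply: ler_sum => i _; rewrite cmodM cmodX exprD mulrA.
  by rewrite -!mulrA ler_wpM2r ?mulr_ge0 ?exprn_ge0 ?cmod_ge0.
rewrite -mulr_sumr ler_wpM2l ?mulr_ge0 ?exprn_ge0 ?cmod_ge0 //.
by rewrite geo_sum_le // cmod_ge0.
Qed.

Lemma peval_le a z M : (forall n, cmod (a n) <= M) -> cmod z < 1 ->
  cmod (peval a z) <= M / (1 - cmod z).
Proof.
move=> hM z1; have := @peval_tail_le a z M 0 hM.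
by rewrite expr0 mulr1; apply.
Qed.

(** Cauchy-Schwarz against the powers of [cmod z], whose squares sum to [1 / (1 - cmod z ^+ 2)]. *)
Lemma l2le_eval_le a z M : l2le a M -> cmod z < 1 ->
  cmod (peval a z) * Num.sqrt (1 - cmod z ^+ 2) <= M.
Proof.
move=> ha z1; have [M0 hM] := ha.
have z0 := cmod_ge0 z.
have q0 : 0 < 1 - cmod z ^+ 2 by rewrite subr_gt0 expr_lt1.
have s0 : 0 < Num.sqrt (1 - cmod z ^+ 2) by rewrite sqrtr_gt0.
rewrite -ler_pdivlMr //.
apply: (cvC_le (N := 0%N) (l2le_cv_ps ha z1)) => n _.
apply: le_trans (cmod_sum _ _ _) _.
under eq_bigr do rewrite cmodM cmodX.
apply: (sum_mul_le (x := fun i => cmod (a i)) (y := fun i => cmod z ^+ i)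
  M0 _ (hM n)).
  by rewrite invr_ge0 ltW.
rewrite exprVn sqr_sqrtr; last exact: ltW.
under eq_bigr do rewrite exprAC.
by apply: geo_sum_le; rewrite sqr_ge0 expr_lt1.
Qed.

Lemma psumD a b z N : psum (fun n => a n + b n) z N = psum a z N + psum b z N.
Proof. by rewrite /psum -big_split; apply: eq_bigr => i _; rewrite mulrDl. Qed.

Lemma psumZ (c : C) a z N : psum (fun n => c * a n) z N = c * psum a z N.
Proof. by rewrite /psum mulr_sumr; apply: eq_bigr => i _; rewrite mulrA. Qed.

End SquareSummable.

(** * Discrete Parseval identity and norm domination *)

Section Domination.
Variable R : realType.
Local Notation C := (Cx R).
Implicit Types (a b g Q : nat -> C) (z : C) (M : R).

(** [X^N - 1] splits and is separable, so it has [N] distinct roots, which forces one of exact order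
    [N]. *)
Lemma prim_root_exists N : (0 < N)%N -> exists z : C, N.-primitive_root z.
Proof.
move=> N0; have [r Dr] := closed_field_poly_normal ('X^N - 1 : {poly C}).
have lc : lead_coef ('X^N - 1 : {poly C}) = 1 by apply/monicP/monicXnsubC.
rewrite lc scale1r in Dr.
suff /hasP[z _ hz] : has N.-primitive_root r by exists z.
apply: has_prim_root => //.
- by apply/allP => z zr; rewrite /root_of_unity Dr root_prod_XsubC.
- by rewrite -separable_prod_XsubC -Dr separable_Xn_sub_1 // pnatr_eq0 -lt0n.
- by have := size_prod_XsubC r id; rewrite -Dr size_XnsubC // => -[->].
Qed.

Lemma cmod_unity N z : (0 < N)%N -> z ^+ N = 1 -> cmod z = 1.
Proof.
move=> N0 zN; apply/eqP; rewrite -(@pexpr_eq1 _ _ N) ?cmod_ge0 //.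
by rewrite -cmodX zN cmod1.
Qed.

Lemma sum_unity_powers N z : z ^+ N = 1 -> z != 1 -> \sum_(j < N) z ^+ j = 0.
Proof.
move=> zN z1; have /esym/eqP := subrX1 z N.
by rewrite zN subrr mulf_eq0 subr_eq0 (negPf z1) => /eqP.
Qed.

(** Orthogonality of characters: off the diagonal, the sum runs over the powers of an [N]-th root of
    unity other than 1. Averages over roots of unity replace integrals over the circle and are exact
    for [N] terms. *)
Lemma parseval_roots N z a : (0 < N)%N -> N.-primitive_root z ->
  \sum_(j < N) cmod (psum a (z ^+ j) N) ^+ 2 = N%:R * \sum_(n < N) cmod (a n) ^+ 2.
Proof.
move=> N0 hz; apply: cof_inj.
have cofS (F : 'I_N -> R) : cof (\sum_(i < N) F i) = \sum_(i < N) cof (F i).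
  by apply: (big_morph _ (@cofD R)).
have cofN : cof N%:R = N%:R := rmorph_nat (real_complex R) N.
have zN := prim_expr_order hz; have z1 := cmod_unity N0 zN.
have zz : z * z^* = 1 by rewrite mulC_conj z1 expr1n.
have z0 : z != 0 by apply/eqP => z0; move: z1; rewrite z0 cmod0 => /eqP; rewrite eq_sym oner_eq0.
have zV : z^* = z^-1 by apply: (mulfI z0); rewrite zz divff.
rewrite cofM !cofS; under eq_bigr do rewrite -mulC_conj /psum rmorph_sum big_distrlr /=.
rewrite exchange_big /= mulr_sumr; apply: eq_bigr => n _.
rewrite exchange_big /= (bigD1 n) //= [X in _ + X]big1 ?addr0.
  under eq_bigr => j _.
    rewrite rmorphM mulrACA mulC_conj -exprM mulC_conj cmodX z1 !expr1n mulr1.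
  over.
  by rewrite sumr_const card_ord cofN mulr_natl.
move=> m mn; under eq_bigr => j _.
  rewrite rmorphM mulrACA rmorphXn /= rmorphXn /= zV.
  rewrite (_ : _ * (z^-1 ^+ j) ^+ m = (z ^+ n * z^-1 ^+ m) ^+ j); last first.
    by rewrite exprMn -!exprM mulnC [(j * m)%N]mulnC.
  over.
rewrite -mulr_sumr sum_unity_powers ?mulr0 //.
  by rewrite exprMn -!exprM mulnC exprM zN expr1n mul1r mulnC exprM exprVn zN invr1 expr1n.
apply: contra mn; rewrite exprVn => /eqP h.
have /eqP : z ^+ m = z ^+ n.
  by apply/esym/(divIf (expf_neq0 m z0)); rewrite h divff // expf_neq0.
by rewrite (eq_prim_root_expr hz) !modn_small ?ltn_ord.
Qed.

(** Parseval on both sides. The slack [e] is there to absorb truncation errors, and [K] bounds the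
    cross term when [(|Q| + e)^2] is expanded. *)
Lemma mean_domination N g Q (e K : R) : (0 < N)%N -> 0 <= e ->
  (forall z, cmod z = 1 -> cmod (psum g z N) <= cmod (psum Q z N) + e) ->
  (forall z, cmod z = 1 -> cmod (psum Q z N) <= K) ->
  \sum_(n < N) cmod (g n) ^+ 2 <=
    \sum_(n < N) cmod (Q n) ^+ 2 + (2 * e * K + e ^+ 2).
Proof.
move=> N0 e0 hg hQ; have [z hz] := prim_root_exists N0.
have NR : 0 < N%:R :> R by rewrite ltr0n.
rewrite -(ler_pM2l NR) mulrDr -!(parseval_roots _ N0 hz).
apply: le_trans (_ : \sum_(j < N) (cmod (psum Q (z ^+ j) N) ^+ 2 + (2 * e * K + e ^+ 2)) <= _).
  apply: ler_sum => j _.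
  have zj : cmod (z ^+ j) = 1.
    by rewrite cmodX (cmod_unity N0 (prim_expr_order hz)) expr1n.
  have h1 := hg _ zj; have h2 := hQ _ zj.
  have h3 := cmod_ge0 (psum Q (z ^+ j) N); have h4 := cmod_ge0 (psum g (z ^+ j) N).
  apply: le_trans (_ : (cmod (psum Q (z ^+ j) N) + e) ^+ 2 <= _).
    by rewrite ler_pXn2r ?nnegrE ?addr_ge0.
  nra.
by rewrite big_split /= sumr_const card_ord -[_ *+ N]mulr_natl.
Qed.

Lemma cvC_bounded (u : nat -> C) l : cvC u l -> exists B : R, forall n, cmod (u n) <= B.
Proof.
move=> h; have [N hN] := h _ ltr01.
exists (cmod l + 1 + \sum_(i < N) cmod (u i)) => n.
have S0 : 0 <= \sum_(i < N) cmod (u i) by apply: sumr_ge0 => i _; exact: cmod_ge0.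
have [nN|Nn] := ltnP n N.
  rewrite (bigD1 (Ordinal nN)) //=.
  have : 0 <= \sum_(i < N | i != Ordinal nN) cmod (u i).
    by apply: sumr_ge0 => i _; exact: cmod_ge0.
  have := cmod_ge0 l; lra.
have := hN _ Nn; have := cmod_triB (u n) l; lra.
Qed.

(** Convergence at the intermediate radius [r'] bounds the terms there, so on [|z| <= r] the tails
    are dominated by a geometric series of ratio [r / r']. *)
Lemma psum_uniform g (G : C -> C) (r e : R) :
  (forall z, disk z -> cvC (psum g z) (G z)) -> 0 <= r < 1 -> 0 < e ->
  exists K, forall N z, (K <= N)%N -> cmod z <= r -> cmod (psum g z N - G z) <= e.
Proof.
move=> hg /andP[r0 r1] e0.
pose r' := (r + 1) / 2; have r'1 : r' < 1 by rewrite /r'; lra.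
have r'0 : 0 < r' by rewrite /r'; lra.
have [B hB] : exists B : R, forall n, cmod (g n) * r' ^+ n <= B.
  have hc : cmod (cof r') < 1 by rewrite cmod_cof // ltW.
  have [B hB] := cvC_bounded (hg _ hc).
  exists (2 * B) => n.
  have -> : r' ^+ n = cmod (cof r' ^+ n) by rewrite cmodX cmod_cof // ltW.
  rewrite -cmodM.
  have -> : g n * cof r' ^+ n = psum g (cof r') n.+1 - psum g (cof r') n.
    by rewrite /psum big_ord_recr /= addrAC subrr add0r.
  have := cmodD (psum g (cof r') n.+1) (- psum g (cof r') n).
  rewrite cmodN; have := hB n; have := hB n.+1; lra.
have B0 : 0 <= B by apply: le_trans (hB 0%N); rewrite expr0 mulr1 cmod_ge0.
pose q := r / r'; have q0 : 0 <= q by rewrite divr_ge0 // ltW.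
have q1 : q < 1 by rewrite ltr_pdivrMr // mul1r /r'; lra.
have e1 : 0 < e * (1 - q) / (B + 1).
  by rewrite divr_gt0 ?mulr_gt0 ?subr_gt0 //; lra.
have [K hK] : exists N, forall n, (N <= n)%N -> q ^+ n < e * (1 - q) / (B + 1).
  by apply: exprn_small => //; rewrite q0.
exists K => N z KN zr.
have zd : disk z by rewrite /disk /=; exact: le_lt_trans r1.
rewrite cmodB.
apply: (cvC_le (N := N) (cvCB (hg z zd) (cvC_cst (psum g z N)))) => n Nn.
rewrite /psum -(subnKC Nn) big_split_ord /= addrAC subrr add0r.
apply: le_trans (cmod_sum _ _ _) _.
apply: le_trans (_ : \sum_(i < n - N) B * q ^+ N * q ^+ i <= _).
  apply: ler_sum => i _; rewrite -mulrA -exprD cmodM cmodX.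
  apply: le_trans (_ : cmod (g (N + i)%N) * r ^+ (N + i) <= _).
    by rewrite ler_wpM2l ?cmod_ge0 // lerXn2r ?nnegrE ?cmod_ge0.
  have -> : r ^+ (N + i) = r' ^+ (N + i) * q ^+ (N + i).
    by rewrite -exprMn /q mulrCA divff ?mulr1 // gt_eqF.
  by rewrite mulrA ler_wpM2r // exprn_ge0.
rewrite -mulr_sumr.
apply: le_trans (_ : B * q ^+ N * (1 - q)^-1 <= _).
  by rewrite ler_wpM2l ?mulr_ge0 ?exprn_ge0 // geo_sum_le // q0.
rewrite ler_pdivrMr ?subr_gt0 //.
have := hK _ KN; rewrite ltr_pdivlMr; last by lra.
have : 0 <= q ^+ N by exact: exprn_ge0.
lra.
Qed.

Lemma bernoulli_le (t : R) k : 0 <= t <= 1 -> 1 - k%:R * t <= (1 - t) ^+ k.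
Proof.
case/andP=> t0 t1; elim: k => [|k IH]; first by rewrite expr0 mul0r subr0.
rewrite exprS -natr1; apply: le_trans (_ : (1 - t) * (1 - k%:R * t) <= _).
  have : 0 <= k%:R * t * t by rewrite !mulr_ge0.
  lra.
by rewrite ler_wpM2l // subr_ge0.
Qed.

(* The averages of [|G|^2] and [|Q|^2] over the N-th roots of unity on a circle of
   radius r < 1 recover, for truncated series, the sums of the squared coefficients. *)
Lemma l2le_dominated g (G : C -> C) Q M :
  (forall z, disk z -> cvC (psum g z) (G z)) -> l2le Q M ->
  (forall z, disk z -> cmod (G z) <= cmod (peval Q z)) -> l2le g M.
Proof.
move=> hg hQ hGQ; have M0 := l2le_ge0 hQ; split=> // L.
have hQc z : disk z -> cvC (psum Q z) (peval Q z) by move=> hz; exact: (l2le_cv_ps hQ).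
have circle (r : R) : 0 <= r < 1 ->
    \sum_(n < L) cmod (g n) ^+ 2 * r ^+ n ^+ 2 <= M ^+ 2.
  move=> hr; have /andP[r0 r1] := hr.
  apply/ler_addgt0Pl => d d0.
  pose K := M / (1 - r); have K0 : 0 <= K by rewrite divr_ge0 // subr_ge0 ltW.
  (* The two truncations give a slack of [2 * e]; since [e <= 1], [mean_domination] then costs at
     most [4 K e + 4 e <= d]. *)
  pose e := Num.min 1 (d / (4 * K + 4)).
  have D0 : 0 < 4 * K + 4 by lra.
  have e0 : 0 < e by rewrite lt_min ltr01 divr_gt0.
  have e1 : e <= 1 by rewrite ge_min lexx.
  have ed : e * (4 * K + 4) <= d by rewrite -ler_pdivlMr // ge_min lexx orbT.
  have [N1 hN1] := psum_uniform hg hr e0; have [N2 hN2] := psum_uniform hQc hr e0.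
  pose N := maxn L.+1 (maxn N1 N2).
  have NL : (L < N)%N by rewrite leq_max ltnSn.
  have NN1 : (N1 <= N)%N by rewrite !leq_max leqnn orbT.
  have NN2 : (N2 <= N)%N by rewrite !leq_max leqnn !orbT.
  have psr a z : psum (fun n => a n * cof r ^+ n) z N = psum a (cof r * z) N.
    by apply: eq_bigr => i _; rewrite exprMn mulrA.
  have rz z : cmod z = 1 -> cmod (cof r * z) <= r.
    by move=> z1; rewrite cmodM z1 mulr1 cmod_cof.
  have hQK z : cmod z = 1 -> cmod (psum (fun n => Q n * cof r ^+ n) z N) <= K.
    move=> z1; apply: le_trans (cmod_sum _ _ _) _.
    apply: le_trans (_ : \sum_(i < N) M * r ^+ i <= _).
      apply: ler_sum => i _; rewrite !cmodM !cmodX z1 expr1n mulr1 cmod_cof //.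
      by rewrite ler_wpM2r ?exprn_ge0 // (l2le_coef _ hQ).
    by rewrite -mulr_sumr ler_wpM2l // geo_sum_le.
  have hgQ z : cmod z = 1 -> cmod (psum (fun n => g n * cof r ^+ n) z N) <=
      cmod (psum (fun n => Q n * cof r ^+ n) z N) + 2 * e.
    move=> z1; rewrite !psr; have hz := rz _ z1.
    have dz : disk (cof r * z) by exact: le_lt_trans hz r1.
    have h1 := hN1 _ _ NN1 hz; have h2 := hN2 _ _ NN2 hz.
    have h3 := hGQ _ dz.
    have h4 := cmod_triB (psum g (cof r * z) N) (G (cof r * z)).
    have h5 := cmod_triB (peval Q (cof r * z)) (psum Q (cof r * z) N).
    rewrite cmodB in h5; lra.
  have e20 : 0 <= 2 * e by lra.
  have := mean_domination (leq_ltn_trans (leq0n _) NL) e20 hgQ hQK.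
  have -> : \sum_(n < N) cmod (g n * cof r ^+ n) ^+ 2 =
      \sum_(n < N) cmod (g n) ^+ 2 * r ^+ n ^+ 2.
    by apply: eq_bigr => n _; rewrite cmodM cmodX cmod_cof // exprMn.
  have hQM : \sum_(n < N) cmod (Q n * cof r ^+ n) ^+ 2 <= M ^+ 2.
    apply: le_trans (hQ.2 N); apply: ler_sum => n _.
    rewrite ler_pXn2r ?nnegrE ?cmod_ge0 // cmodM cmodX cmod_cof //.
    by rewrite ler_piMr ?cmod_ge0 // exprn_ile1 // ltW.
  have hL : \sum_(n < L) cmod (g n) ^+ 2 * r ^+ n ^+ 2 <=
      \sum_(n < N) cmod (g n) ^+ 2 * r ^+ n ^+ 2.
    rewrite -(subnKC (ltnW NL)) [leRHS]big_split_ord /= lerDl.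
    by apply: sumr_ge0 => i _; rewrite mulr_ge0 ?sqr_ge0.
  have : (2 * e) ^+ 2 <= 4 * e by nra.
  nra.
set S := \sum_(n < L) _.
have S0 : 0 <= S by apply: sumr_ge0 => i _; exact: sqr_ge0.
apply/ler_addgt0Pl => d d0.
(* The radius [1 - t] now tends to 1: for [i < L] its power [2 i] is at least its power [k], hence
   at least [1 - k t] by Bernoulli. *)
pose k := (L * 2)%N.
have D0 : 0 < S * k%:R + 1 by have : 0 <= S * k%:R by [rewrite mulr_ge0]; lra.
pose t := Num.min 1 (d / (S * k%:R + 1)).
have t0 : 0 < t by rewrite lt_min ltr01 divr_gt0.
have t1 : t <= 1 by rewrite ge_min lexx.
have td : t * (S * k%:R + 1) <= d by rewrite -ler_pdivlMr // ge_min lexx orbT.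
have t01 : 0 <= t <= 1 by rewrite ltW.
have r01 : 0 <= 1 - t < 1 by rewrite subr_ge0 t1 /= gtrBl.
have h := circle _ r01.
suff : (1 - t) ^+ k * S <= M ^+ 2.
  have := bernoulli_le k t01; nra.
apply: le_trans h; rewrite /S mulr_sumr; apply: ler_sum => i _.
have /andP[r0 r1] := r01.
rewrite mulrC ler_wpM2l ?sqr_ge0 // /k exprM ler_pXn2r ?nnegrE ?exprn_ge0 //.
by apply: (ler_wiXn2l r0 (ltW r1)); exact: ltnW.
Qed.

Lemma l2le_dominatedZ g (G : C -> C) Q M (c : R) : 0 <= c ->
  (forall z, disk z -> cvC (psum g z) (G z)) -> l2le Q M ->
  (forall z, disk z -> cmod (G z) <= c * cmod (peval Q z)) -> l2le g (c * M).
Proof.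
move=> c0 hg hQ hGQ; have hc := l2leZ (cof c) hQ; rewrite cmod_cof // in hc.
apply: (l2le_dominated hg hc) => z hz.
rewrite (@peval_cv _ _ _ (cof c * peval Q z)).
  by rewrite cmodM cmod_cof //; exact: hGQ.
by have := cvCZ (cof c) (l2le_cv_ps hQ hz); apply: cvC_ext => N; rewrite psumZ.
Qed.

(** The difference is dominated by the zero function, so its coefficients have norm zero. *)
Lemma peval_inj a b M M' : l2le a M -> l2le b M' ->
  (forall z, disk z -> peval a z = peval b z) -> a = b.
Proof.
move=> ha hb hab.
have : l2le (fun n => a n + - 1 * b n) 0.
  apply: (@l2le_dominated _ (fun=> 0) (fun=> 0) 0 _ (l2le0 R)) => z hz; last first.
    by rewrite cmod0 cmod_ge0.
  have := cvCB (l2le_cv_ps ha hz) (l2le_cv_ps hb hz); rewrite hab // subrr.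
  by apply: cvC_ext => N; rewrite psumD psumZ mulN1r.
move=> h; apply/funext => n; apply/eqP; rewrite -subr_eq0; apply/eqP/cmod_eq0/eqP.
rewrite eq_le cmod_ge0 andbT; have := l2le_coef n h; by rewrite mulN1r.
Qed.

End Domination.

(** * Bounded families in H^2: compactness, limits and multipliers *)

Section WeakCompactness.
Variable R : realType.
Local Notation C := (Cx R).
Implicit Types (a b : nat -> C) (f g u : C -> C) (z : C) (M : R).

(** Tychonoff's theorem on a product of segments [[-M, M]], one factor for each real or imaginary
    part of each coefficient, provides a cluster point. *)
Lemma coef_cluster (A : nat -> nat -> C) M : (forall k n, cmod (A k n) <= M) ->
  exists a, forall N K (e : R), 0 < e ->
    exists2 k, (K <= k)%N & forall n, (n < N)%N -> cmod (A k n - a n) < e.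
Proof.
move=> hA.
pose X k (i : nat * bool) : R :=
  if i.2 then complex.Re (A k i.1) else complex.Im (A k i.1).
pose F := X @ \oo.
have cpt := @tychonoff (nat * bool)%type (fun=> R)
  (fun=> `[- M, M]%classic) (fun=> @segment_compact R (- M) M).
have FF : ProperFilter F by exact: fmap_proper_filter.
have FK : F [set f | forall i : nat * bool, `[- M, M]%classic (f i)].
  exists 0%N => // k _ i /=; rewrite in_itv /= -ler_norml /X.
  apply: le_trans (hA k i.1); case: ifP => _; first exact: le_cmod_Re.
  exact: le_cmod_Im.
have [x [_ hx]] := cpt F FF FK.
exists (fun n => Complex (x (n, true)) (x (n, false))) => N K e e0.
pose B (ib : 'I_N * bool) :=
  [set y : nat * bool -> R | `|x (val ib.1, ib.2) - y (val ib.1, ib.2)| < e / 2].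
have Bx : \forall y \near nbhs x, forall ib, B ib y.
  apply: filter_forall => ib.
  have e2 : 0 < e / 2 by lra.
  have hb := @nbhsx_ballx R R (x (val ib.1, ib.2)) (e / 2) e2.
  exact: (@proj_continuous _ (fun=> R) (val ib.1, ib.2) x _ hb).
have FX : F (X @` [set k | (K <= k)%N]).
  by exists K => // k /= Kk; exists k.
have [_ [[k Kk <-] hB]] := hx _ _ FX Bx.
exists k => // n nN.
have := hB (Ordinal nN, true); have := hB (Ordinal nN, false).
rewrite /B /X /= distrC => h1; rewrite distrC => h2.
apply: le_lt_trans (cmod_le_ReIm _) _.
by move: h1 h2; case: (A k n) => c d /=; lra.
Qed.

(** Diagonal extraction: the [j]-th index is chosen beyond the previous one, with the first [j]
    coefficients within [1 / (j + 1)] of the cluster point. *)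
Lemma coef_subseq (A : nat -> nat -> C) M : (forall k n, cmod (A k n) <= M) ->
  exists (s : nat -> nat) a, (forall k, (s k < s k.+1)%N) /\
    forall n, cvC (fun k => A (s k) n) (a n).
Proof.
move=> /coef_cluster[a ha].
have hc (jK : nat * nat) : exists k, (jK.2 <= k)%N /\
    forall n, (n < jK.1)%N -> cmod (A k n - a n) < jK.1.+1%:R^-1.
  have [|k hk hk'] := ha jK.1 jK.2 jK.1.+1%:R^-1; first by rewrite invr_gt0 ltr0n.
  by exists k.
have [F hF] := choice hc.
pose s := fix s j := F (j, if j is j'.+1 then (s j').+1 else 0%N).
have sE j : s j = F (j, if j is j'.+1 then (s j').+1 else 0%N) by case: j.
exists s, a; split=> [k|n e e0]; first by rewrite (sE k.+1); exact: (hF (_, _)).1.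
have [N hN] : exists N, forall j, (N <= j)%N -> j.+1%:R^-1 < e.
  have /cvgrPdist_lt/(_ _ e0)[N _ hN] := @cvg_harmonic R.
  by exists N => j /hN; rewrite sub0r normrN ger0_norm ?invr_ge0.
exists (maxn n.+1 N) => j; rewrite geq_max => /andP[nj Nj].
rewrite sE; apply: lt_trans (hN _ Nj).
exact: (hF (j, _)).2.
Qed.

(** The first [N] coefficients are small for large [k], and the remaining ones contribute at most
    [M r^N / (1 - r)], uniformly in [k]. *)
Lemma peval_unif_small (d : nat -> nat -> C) M (r e : R) :
  (forall k n, cmod (d k n) <= M) -> (forall n, cvC (fun k => d k n) 0) ->
  0 <= r < 1 -> 0 < e ->
  exists K, forall k z, (K <= k)%N -> cmod z <= r -> cmod (peval (d k) z) <= e.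
Proof.
move=> hM h0 hr e0; have /andP[r0 r1] := hr.
have M0 : 0 <= M := le_trans (cmod_ge0 _) (hM 0%N 0%N).
have e1 : 0 < e / 2 * (1 - r) / (M + 1) by rewrite divr_gt0 ?mulr_gt0 ?subr_gt0 //; lra.
have [N hN] := exprn_small hr e1.
pose t := e / 2 / N.+1%:R; have t0 : 0 < t by rewrite divr_gt0 ?ltr0n //; lra.
have [K hK] := choice (fun n => h0 n t t0).
exists (\max_(i < N) K i) => k z Kk zr.
have z1 : cmod z < 1 by exact: le_lt_trans r1.
have small n : (n < N)%N -> cmod (d k n) <= t.
  move=> nN; apply/ltW; rewrite -[d k n]subr0; apply: hK.
  exact: leq_trans (@leq_bigmax _ (fun i : 'I_N => K i) (Ordinal nN)) Kk.
apply: (cvC_le (N := N) (cvC_ps (hM k) z1)) => n Nn.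
apply: le_trans (cmod_sum _ _ _) _.
rewrite -(subnKC Nn) big_split_ord /=.
have h1 : \sum_(i < N) cmod (d k i * z ^+ i) <= e / 2.
  apply: le_trans (_ : \sum_(i < N) t <= _).
    apply: ler_sum => i _; rewrite cmodM cmodX.
    apply: le_trans (small _ (ltn_ord i)); rewrite ler_piMr ?cmod_ge0 //.
    by rewrite exprn_ile1 ?cmod_ge0 // ltW.
  rewrite sumr_const card_ord -[_ *+ N]mulr_natr /t mulrAC ler_pdivrMr ?ltr0n //.
  rewrite ler_wpM2l ?ler_nat //; lra.
have h2 : \sum_(i < n - N) cmod (d k (N + i)%N * z ^+ (N + i)) <= e / 2.
  apply: le_trans (_ : \sum_(i < n - N) M * r ^+ N * r ^+ i <= _).
    apply: ler_sum => i _; rewrite -mulrA -exprD cmodM cmodX.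
    by apply: ler_pM; rewrite ?cmod_ge0 ?exprn_ge0 ?cmod_ge0 ?lerXn2r ?nnegrE ?cmod_ge0.
  rewrite -mulr_sumr; apply: le_trans (_ : M * r ^+ N * (1 - r)^-1 <= _).
    by rewrite ler_wpM2l ?mulr_ge0 ?exprn_ge0 // geo_sum_le.
  rewrite ler_pdivrMr ?subr_gt0 //.
  have := hN _ (leqnn N); rewrite ltr_pdivlMr; last by lra.
  have : 0 <= r ^+ N by exact: exprn_ge0.
  lra.
lra.
Qed.

(** Functions are total, so membership in H^2 concerns the restriction to the disk; [M] is an upper
    bound of the norm, which lets estimates chain without computing norms. *)
Definition H2le f M := exists a, l2le a M /\ forall z, disk z -> peval a z = f z.

Lemma H2le_ge0 f M : H2le f M -> 0 <= M.
Proof. by case=> a [/l2le_ge0]. Qed.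

Lemma H2le_ext f g M : (forall z, disk z -> f z = g z) -> H2le f M -> H2le g M.
Proof. by move=> h [a [ha he]]; exists a; split=> // z hz; rewrite he // h. Qed.

Lemma H2le_le f M M' : M <= M' -> H2le f M -> H2le f M'.
Proof. by move=> h [a [ha he]]; exists a; split=> //; exact: l2le_le ha. Qed.

Lemma H2le_peval a M : l2le a M -> H2le (peval a) M.
Proof. by move=> h; exists a. Qed.

Lemma H2leD f g M M' : H2le f M -> H2le g M' -> H2le (fun z => f z + g z) (M + M').
Proof.
move=> [a [ha ea]] [b [hb eb]]; exists (fun n => a n + b n); split; first exact: l2leD.
move=> z hz; apply: peval_cv; rewrite -ea // -eb //.
have := cvCD (l2le_cv_ps ha hz) (l2le_cv_ps hb hz).
by apply: cvC_ext => N; rewrite psumD.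
Qed.

Lemma H2leZ (c : C) f M : H2le f M -> H2le (fun z => c * f z) (cmod c * M).
Proof.
move=> [a [ha ea]]; exists (fun n => c * a n); split; first exact: l2leZ.
move=> z hz; apply: peval_cv; rewrite -ea //.
by have := cvCZ c (l2le_cv_ps ha hz); apply: cvC_ext => N; rewrite psumZ.
Qed.

Lemma H2leB f g M M' : H2le f M -> H2le g M' -> H2le (fun z => f z - g z) (M + M').
Proof.
move=> hf /(H2leZ (-1)); rewrite cmodN cmod1 mul1r => hg.
by apply: H2le_ext (H2leD hf hg) => z _; rewrite mulN1r.
Qed.

Lemma l2le_cmod_le a b M : (forall n, cmod (b n) <= cmod (a n)) -> l2le a M -> l2le b M.
Proof.
move=> h [M0 hM]; split=> // N; apply: le_trans (hM N); apply: ler_sum => i _.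
by rewrite ler_pXn2r ?nnegrE ?cmod_ge0.
Qed.

Definition head N a n : C := if (n < N)%N then a n else 0.
Definition tail N a n : C := if (n < N)%N then 0 else a n.

Lemma l2le_head N a M : l2le a M -> l2le (head N a) M.
Proof. by apply: l2le_cmod_le => n; rewrite /head; case: ifP; rewrite ?cmod0 ?cmod_ge0. Qed.

Lemma l2le_tail N a M : l2le a M -> l2le (tail N a) M.
Proof. by apply: l2le_cmod_le => n; rewrite /tail; case: ifP; rewrite ?cmod0 ?cmod_ge0. Qed.

Lemma peval_head N a z : peval (head N a) z = psum a z N.
Proof.
apply: peval_cv => e e0; exists N => n Nn.
suff -> : psum (head N a) z n = psum a z N by rewrite subrr cmod0.
rewrite /psum -(subnKC Nn) big_split_ord /= [X in _ + X]big1 ?addr0 => [|i _].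
  by apply: eq_bigr => i _; rewrite /head ltn_ord.
by rewrite /head ltnNge leq_addr /= mul0r.
Qed.

Lemma H2le_ps a M N : l2le a M -> H2le (psum a ^~ N) M.
Proof. by move=> h; exists (head N a); split=> [|z _]; [exact: l2le_head|exact: peval_head]. Qed.

Lemma H2le_cst (c : C) : H2le (fun=> c) (cmod c).
Proof.
exists (head 1 (fun=> c)); split=> [|z _]; last first.
  by rewrite peval_head /psum big_ord1 expr0 mulr1.
split=> [|N]; first exact: cmod_ge0.
case: N => [|N]; first by rewrite big_ord0 sqr_ge0.
rewrite big_ord_recl big1 => [|i _]; first by rewrite addr0.
by rewrite /head lift0 cmod0 expr0n.
Qed.

Lemma H2le_mulX f M : H2le f M -> H2le (fun z => z * f z) M.
Proof.
move=> [a [ha ea]]; exists (fun n => if n is m.+1 then a m else 0); split.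
  split=> [|N]; first exact: l2le_ge0 ha.
  case: N => [|N]; first by rewrite big_ord0 sqr_ge0.
  by rewrite big_ord_recl cmod0 expr0n add0r; exact: ha.2.
move=> z hz; apply: peval_cv; rewrite -ea //.
have h := cvCZ z (l2le_cv_ps ha hz); move=> e /h[N hN]; exists N.+1 => -[//|n] Nn.
have := hN _ Nn; rewrite /psum big_ord_recl mul0r add0r mulr_sumr.
rewrite (eq_bigr (fun i : 'I_n => a i * z ^+ (bump 0 i))) //.
by move=> i _; rewrite exprS mulrCA.
Qed.

Lemma H2le_monomial n : H2le (fun z => z ^+ n) 1.
Proof.
elim: n => [|n IH]; first by have := H2le_cst 1; rewrite cmod1.
by apply: H2le_ext (H2le_mulX IH) => z _; rewrite exprS.
Qed.

(** The hypothesis on [g] supplies its power series, and the pointwise comparison its size. *)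
Lemma H2le_dominated g Q M M' (c : R) : 0 <= c -> H2le g M' -> H2le Q M ->
  (forall z, disk z -> cmod (g z) <= c * cmod (Q z)) -> H2le g (c * M).
Proof.
move=> c0 [a [ha ea]] [b [hb eb]] h; exists a; split=> //.
apply: (l2le_dominatedZ c0 (G := peval a) _ hb) => z hz; first exact: (l2le_cv_ps ha).
by rewrite ea // eb //; exact: h.
Qed.

Lemma H2le_bounded g M' (c : R) : 0 <= c -> H2le g M' ->
  (forall z, disk z -> cmod (g z) <= c) -> H2le g c.
Proof.
move=> c0 hg h; rewrite -[c]mulr1 -(cmod1 R).
apply: (H2le_dominated c0 hg (H2le_cst 1)) => z hz.
by rewrite cmod1 mulr1; exact: h.
Qed.

(** Comparison with the constant function [c]. *)
Lemma H2le_analytic f (c : R) : 0 <= c -> analytic_on_disk f ->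
  (forall z, disk z -> cmod (f z) <= c) -> H2le f c.
Proof.
move=> c0 [a ha] hf.
have hc z : disk z -> cvC (psum a z) (f z) by move=> hz; apply/pseries_toP/ha.
exists a; split=> [|z hz]; last by apply: peval_cv; exact: hc.
have [b [hb eb]] := H2le_cst (cof c); rewrite cmod_cof // in hb.
apply: (l2le_dominated hc hb) => z hz.
by rewrite eb // cmod_cof //; exact: hf.
Qed.

Lemma H2le_eval f M z : H2le f M -> disk z ->
  cmod (f z) * Num.sqrt (1 - cmod z ^+ 2) <= M.
Proof. by move=> [a [ha ea]] hz; rewrite -ea //; exact: l2le_eval_le. Qed.

Lemma H2le_eval_le f M z : H2le f M -> disk z -> cmod (f z) <= M / (1 - cmod z).
Proof.
move=> [a [ha ea]] hz; rewrite -ea //; apply: peval_le => // n.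
exact: l2le_coef ha.
Qed.

Lemma subseq_ge (s : nat -> nat) : (forall k, (s k < s k.+1)%N) ->
  forall k, (k <= s k)%N.
Proof. by move=> h; elim=> // k IH; exact: leq_ltn_trans (h k). Qed.

(** Montel's theorem for a ball of H^2: for a bounded sequence, coefficientwise convergence forces
    uniform convergence on smaller disks. *)
Lemma l2le_subseq (A : nat -> nat -> C) M : (forall k, l2le (A k) M) ->
  exists (s : nat -> nat) a, [/\ (forall k, (s k < s k.+1)%N), l2le a M &
    forall r e : R, 0 <= r < 1 -> 0 < e -> exists K, forall k z, (K <= k)%N ->
      cmod z <= r -> cmod (peval (A (s k)) z - peval a z) <= e].
Proof.
move=> hA; have [k n|s [a [hs ha]]] := coef_subseq (A := A) (M := M).
  exact: l2le_coef.
have hs' := subseq_ge hs.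
have bda : l2le a M by apply: (l2le_cv (A := fun k => A (s k))).
exists s, a; split=> // r e hr e0.
pose d k n := A (s k) n + -1 * a n.
have dM k n : cmod (d k n) <= M + M.
  apply: le_trans (cmodD _ _) _; rewrite mulN1r cmodN.
  by apply: lerD; [exact: l2le_coef (hA _)|exact: l2le_coef bda].
have d0 n : cvC (fun k => d k n) 0.
  rewrite -(subrr (a n)); have := cvCB (ha n) (cvC_cst (a n)).
  by apply: cvC_ext => k; rewrite /d mulN1r.
have [K hK] := peval_unif_small dM d0 hr e0.
exists K => k z Kk zr; have z1 : cmod z < 1 by case/andP: hr => _; exact: le_lt_trans.
have -> : peval (A (s k)) z - peval a z = peval (d k) z; last exact: hK.
apply/esym/peval_cv; have := cvCB (l2le_cv_ps (hA (s k)) z1) (l2le_cv_ps bda z1).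
by apply: cvC_ext => N; rewrite psumD psumZ mulN1r.
Qed.

Lemma H2le_weak_compact (f : nat -> C -> C) M : (forall k, H2le (f k) M) ->
  exists (s : nat -> nat) g, [/\ (forall k, (s k < s k.+1)%N), H2le g M &
    forall z, disk z -> cvC (fun k => f (s k) z) (g z)].
Proof.
move=> /choice[A hA]; have [|s [a [hs ba ha]]] := @l2le_subseq A M.
  by move=> k; case: (hA k).
exists s, (peval a); split=> // [|z hz e e0]; first exact: H2le_peval.
have hz' : 0 <= cmod z < 1 by rewrite cmod_ge0.
have [|K hK] := ha (cmod z) (e / 2) hz'; first by lra.
exists K => k Kk; rewrite -(hA (s k)).2 //; have := hK k z Kk (lexx _); lra.
Qed.

(** The weak limit of a subsequence must coincide on the disk with the given pointwise limit. *)
Lemma H2le_lim (f : nat -> C -> C) g M : (forall k, H2le (f k) M) ->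
  (forall z, disk z -> cvC (fun k => f k z) (g z)) -> H2le g M.
Proof.
move=> hf hg; have [s [g' [hs hg' c]]] := H2le_weak_compact hf.
apply: H2le_ext hg' => z hz; apply: cvC_uniq (c z hz) _.
exact: (cvC_sub (subseq_ge hs) (hg z hz)).
Qed.

(** For a polynomial [f] the product lies in H^2 by shifts and sums, and domination gives the bound
    [c * M]; the general case is a limit of these. *)
Lemma H2le_mul u f M M' (c : R) : 0 <= c -> H2le u M' ->
  (forall z, disk z -> cmod (u z) <= c) -> H2le f M ->
  H2le (fun z => u z * f z) (c * M).
Proof.
move=> c0 hu uc [a [ha ea]].
have hX n : H2le (fun z => z ^+ n * u z) M'.
  elim: n => [|n IH]; first by apply: H2le_ext hu => z _; rewrite expr0 mul1r.
  by apply: H2le_ext (H2le_mulX IH) => z _; rewrite exprS mulrA.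
have hps N : exists M'', H2le (fun z => u z * psum a z N) M''.
  elim: N => [|N [M'' IH]].
    by exists (cmod (0 : C)); apply: H2le_ext (H2le_cst 0) => z _; rewrite /psum big_ord0 mulr0.
  exists (M'' + cmod (a N) * M'); apply: H2le_ext (H2leD IH (H2leZ (a N) (hX N))) => z _.
  by rewrite /psum big_ord_recr /= mulrDr; congr (_ + _); rewrite mulrA mulrC.
apply: (H2le_lim (f := fun N z => u z * psum a z N)) => [N|z hz]; last first.
  by rewrite -ea //; apply: cvCZ; exact: (l2le_cv_ps ha).
have [M'' hM''] := hps N; apply: (H2le_dominated c0 hM'' (H2le_ps N ha)) => z hz.
by rewrite cmodM ler_wpM2r ?cmod_ge0 ?uc.
Qed.

End WeakCompactness.

(** * Reproducing kernels, disk automorphisms and Littlewood's argument *)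

Section Kernels.
Variable R : realType.
Local Notation C := (Cx R).
Implicit Types (a b y : nat -> C) (f g u phi : C -> C) (z p l c : C) (M : R).

(* The inverse of the norm of the reproducing kernel of H^2 at p. *)
Definition kdist p : R := Num.sqrt (1 - cmod p ^+ 2).

(** The reproducing kernel at [p] divided by its norm. *)
Definition nker p z : C := cof (kdist p) / (1 - p^* * z).

Lemma cmod_sq_lt1 z : disk z -> 0 < 1 - cmod z ^+ 2.
Proof. by move=> hz; rewrite subr_gt0 expr_lt1 ?cmod_ge0. Qed.

Lemma kdist_gt0 p : disk p -> 0 < kdist p.
Proof. by move=> hp; rewrite sqrtr_gt0 cmod_sq_lt1. Qed.

Lemma kdist_sq p : disk p -> kdist p ^+ 2 = 1 - cmod p ^+ 2.
Proof. by move=> hp; rewrite sqr_sqrtr // ltW // cmod_sq_lt1. Qed.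

Lemma cmodM_lt1 z l : disk z -> cmod l <= 1 -> cmod (z * l) < 1.
Proof.
move=> hz hl; rewrite cmodM; apply: le_lt_trans hz.
by rewrite ler_piMr ?cmod_ge0.
Qed.

Lemma one_sub_neq0 z : cmod z < 1 -> 1 - z != 0.
Proof.
move=> h; rewrite subr_eq0; apply/eqP => h1; move: h; rewrite -h1 cmod1.
by rewrite ltxx.
Qed.

Lemma conj_disk p : disk p -> disk p^*.
Proof. by rewrite /disk /mkset cmod_conj. Qed.

Lemma den_neq0 p z : disk p -> cmod z <= 1 -> 1 - p^* * z != 0.
Proof. by move=> hp hz; apply/one_sub_neq0/cmodM_lt1 => //; exact: conj_disk. Qed.

Lemma cvC_pow z : cmod z < 1 -> cvC (fun n => z ^+ n) 0.
Proof.
move=> hz e e0; have [|N hN] := @exprn_small R (cmod z) e _ e0.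
  by rewrite cmod_ge0.
by exists N => n /hN; rewrite subr0 cmodX.
Qed.

Lemma cvC_geometric c l z : cmod (l * z) < 1 ->
  cvC (psum (fun n => c * l ^+ n) z) (c / (1 - l * z)).
Proof.
move=> h; have n0 := one_sub_neq0 h.
have := cvCZ (c / (1 - l * z)) (cvCB (cvC_cst 1) (cvC_pow h)).
rewrite subr0 mulr1; apply: cvC_ext => N.
have -> : 1 - (l * z) ^+ N = (1 - l * z) * \sum_(i < N) (l * z) ^+ i.
  by rewrite -[LHS]opprB subrX1 -mulNr opprB.
rewrite mulrA divfK // mulr_sumr; apply: eq_bigr => i _.
by rewrite exprMn mulrA.
Qed.

Definition nkerc p n : C := cof (kdist p) * p^* ^+ n.

Lemma peval_nker p z : disk p -> disk z -> peval (nkerc p) z = nker p z.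
Proof.
move=> hp hz; apply/peval_cv/cvC_geometric; apply: cmodM_lt1 => //; last exact: ltW.
exact: conj_disk.
Qed.

Lemma l2le_nker p : disk p -> l2le (nkerc p) 1.
Proof.
move=> hp; split=> // N; rewrite expr1n.
have -> : \sum_(i < N) cmod (nkerc p i) ^+ 2 =
    (1 - cmod p ^+ 2) * \sum_(i < N) (cmod p ^+ 2) ^+ i.
  rewrite mulr_sumr; apply: eq_bigr => i _.
  rewrite cmodM exprMn cmod_cof ?sqrtr_ge0 // kdist_sq // cmodX cmod_conj.
  by rewrite exprAC.
rewrite -ler_pdivlMl ?cmod_sq_lt1 // mulr1.
by apply: geo_sum_le; rewrite sqr_ge0 expr_lt1 ?cmod_ge0.
Qed.

Lemma H2le_nker p : disk p -> H2le (nker p) 1.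
Proof.
by move=> hp; exists (nkerc p); split=> [|z hz]; [exact: l2le_nker|exact: peval_nker].
Qed.

Lemma nker_diag p : disk p -> nker p p = cof (kdist p)^-1.
Proof.
move=> hp; rewrite /nker mulrC [p^* * p]mulrC mulC_conj -cof1.
rewrite -cofB -kdist_sq //.
rewrite -cofV -cofM expr2 invfM mulfVK //.
by rewrite gt_eqF // kdist_gt0.
Qed.

(* A function vanishing at p is orthogonal to the kernel at p. *)
Lemma l2le_pythagoras p c y M : disk p -> l2le y M -> peval y p = 0 ->
  l2le (fun n => c * nkerc p n + y n) (Num.sqrt (cmod c ^+ 2 + M ^+ 2)).
Proof.
move=> hp hy y0; apply: l2le_sqrt => N.
set S := fun N => \sum_(i < N) cmod (c * nkerc p i + y i) ^+ 2.
(* In the expanded square, the cross terms add up to a multiple of the conjugate partial sum of [y]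
   at [p], which tends to zero. *)
have cross L : S L <= cmod c ^+ 2 + M ^+ 2 +
    2 * cmod (c * cof (kdist p) * (psum y p L)^*).
  rewrite /S; under eq_bigr do rewrite cmod_sqD.
  rewrite !big_split /= -mulr_sumr.
  have h1 := (l2leZ c (l2le_nker hp)).2 L; rewrite mulr1 in h1.
  have h2 := hy.2 L.
  rewrite -Re_sum.
  have -> : \sum_(i < L) c * nkerc p i * (y i)^* = c * cof (kdist p) * (psum y p L)^*.
    rewrite /psum rmorph_sum mulr_sumr; apply: eq_bigr => i _.
    by rewrite rmorphM rmorphXn /nkerc /=; ring.
  have := le_cmod_Re (c * cof (kdist p) * (psum y p L)^*).
  set w := c * _ * _; have := ler_norm (complex.Re w).
  lra.
apply/ler_addgt0Pl => e e0.
have := cvCZ (c * cof (kdist p)) (cvC_conj (l2le_cv_ps hy hp)).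
rewrite y0 conjC0 mulr0 => h; have [|K hK] := h (e / 2); first by lra.
have := hK _ (leq_maxr N K); rewrite subr0 => h1; have h2 := cross (maxn N K).
suff : S N <= S (maxn N K) by rewrite /S in h2 *; lra.
rewrite /S -(subnKC (leq_maxl N K)) big_split_ord /= lerDl.
by apply: sumr_ge0 => i _; exact: sqr_ge0.
Qed.

Lemma H2le_pythagoras p c g M : disk p -> H2le g M -> g p = 0 ->
  H2le (fun z => c * nker p z + g z) (Num.sqrt (cmod c ^+ 2 + M ^+ 2)).
Proof.
move=> hp [y [hy ey]] g0; exists (fun n => c * nkerc p n + y n); split.
  by apply: l2le_pythagoras => //; rewrite ey.
move=> z hz; apply: peval_cv; rewrite -peval_nker // -ey //.
have := cvCD (cvCZ c (l2le_cv_ps (l2le_nker hp) hz)) (l2le_cv_ps hy hz).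
by apply: cvC_ext => N; rewrite psumD psumZ.
Qed.

Lemma psS a z N : psum a z N.+1 = a 0%N + z * psum (fun n => a n.+1) z N.
Proof.
rewrite /psum big_ord_recl expr0 mulr1 mulr_sumr; congr (_ + _).
by apply: eq_bigr => i _; rewrite lift0 exprS mulrCA.
Qed.

(** Littlewood's induction: with [a'] the shift of [a], the function is
    [a 0 * nker p + u * (nker p * a' (u))]. The second term vanishes at [p], hence is orthogonal to
    [nker p], and multiplication by [u] does not increase norms. *)
Lemma H2le_nker_poly u p a N M : disk p -> H2le u M ->
  (forall z, disk z -> cmod (u z) <= 1) -> u p = 0 ->
  H2le (fun z => nker p z * psum a (u z) N) (Num.sqrt (\sum_(i < N) cmod (a i) ^+ 2)).
Proof.
move=> hp hu u1 up; elim: N a => [|N IH] a.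
  apply: (H2le_le (M := cmod 0)); first by rewrite cmod0 sqrtr_ge0.
  by apply: H2le_ext (H2le_cst 0) => z _; rewrite /psum big_ord0 mulr0.
have h1 := H2le_mul ler01 hu u1 (IH (fun n => a n.+1)); rewrite mul1r in h1.
have := H2le_pythagoras (a 0%N) hp h1; rewrite up mul0r => /(_ erefl).
rewrite sqr_sqrtr; last by apply: sumr_ge0 => i _; exact: sqr_ge0.
rewrite big_ord_recl; apply: H2le_ext => z hz.
rewrite psS mulrDr mulrC; congr (_ + _); by rewrite mulrCA.
Qed.

Lemma H2le_nker_comp u p f M M' : disk p -> H2le u M' ->
  (forall z, disk z -> disk (u z)) -> u p = 0 -> H2le f M ->
  H2le (fun z => nker p z * f (u z)) M.
Proof.
move=> hp hu u1 up [a [ha ea]].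
apply: (H2le_lim (f := fun N z => nker p z * psum a (u z) N)) => [N|z hz]; last first.
  rewrite -ea; last exact: u1.
  by apply: cvCZ; apply: (l2le_cv_ps ha); exact: u1.
apply: (H2le_le (M := Num.sqrt (\sum_(i < N) cmod (a i) ^+ 2))).
  by rewrite -[leRHS]ger0_norm ?(l2le_ge0 ha) // -sqrtr_sqr ler_wsqrtr // ha.2.
by apply: (H2le_nker_poly _ _ hp hu) => // z /u1/ltW.
Qed.

(** Only membership in H^2 is recorded; a pointwise bound sharpens the size afterwards. *)
Lemma H2le_poly_comp u a N M : H2le u M -> (forall z, disk z -> cmod (u z) <= 1) ->
  exists M', H2le (fun z => psum a (u z) N) M'.
Proof.
move=> hu u1; elim: N a => [|N IH] a.
  by exists (cmod 0); apply: H2le_ext (H2le_cst 0) => z _; rewrite /psum big_ord0.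
have [M' h] := IH (fun n => a n.+1).
exists (cmod (a 0%N) + 1 * M').
apply: H2le_ext (H2leD (H2le_cst (a 0%N)) (H2le_mul ler01 hu u1 h)) => z _.
by rewrite psS.
Qed.

(** For [l] in the disk, the involutive automorphism of the disk that exchanges [0] and [l]. *)
Definition moebius l z : C := (l - z) / (1 - l^* * z).

Lemma moebius_disk l z : disk l -> disk z -> disk (moebius l z).
Proof.
move=> hl hz; have n0 := den_neq0 hl (ltW hz).
have d0 : 0 < cmod (1 - l^* * z).
  by rewrite lt_neqAle cmod_ge0 andbT; apply: contra n0 => /eqP/esym/cmod_eq0 ->.
rewrite /disk /mkset cmodM cmodV ltr_pdivrMr // mul1r.
rewrite -(ltr_pXn2r (n := 2)) ?nnegrE ?cmod_ge0 // -subr_gt0.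
(* The squared modulus of the denominator minus that of the numerator equals this product. *)
have := mulr_gt0 (cmod_sq_lt1 hl) (cmod_sq_lt1 hz).
by rewrite !cmod_sq; case: l {hl n0 d0} => ? ?; case: z {hz} => ? ? /=; lra.
Qed.

Lemma moebiusxx l : moebius l l = 0.
Proof. by rewrite /moebius subrr mul0r. Qed.

Lemma one_sub_moebius l z : disk l -> disk z ->
  1 - l^* * moebius l z = (1 - l^* * l) / (1 - l^* * z).
Proof.
move=> hl hz; have n0 := den_neq0 hl (ltW hz).
by rewrite /moebius; field.
Qed.

Lemma moebiusK l z : disk l -> disk z -> moebius l (moebius l z) = z.
Proof.
move=> hl hz; have n0 := den_neq0 hl (ltW hz).
have n1 := den_neq0 hl (ltW hl).
rewrite {1}/moebius one_sub_moebius // /moebius; field.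
by rewrite n0.
Qed.

(** The inverse of the denominator is the limit of geometric partial sums in [phi], uniformly
    bounded by [1 / (1 - |l|)]. Its product with [l - phi] lies in H^2, and since the values lie in
    the disk the norm is at most 1. *)
Lemma H2le_moebius_comp l phi M : disk l -> H2le phi M ->
  (forall z, disk z -> disk (phi z)) -> H2le (fun z => moebius l (phi z)) 1.
Proof.
move=> hl hphi h; have h1 z : disk z -> cmod (phi z) <= 1 by move=> /h/ltW.
have l1 : 0 < 1 - cmod l by rewrite subr_gt0.
have L0 : 0 <= (1 - cmod l)^-1 by rewrite invr_ge0 ltW.
have inv : H2le (fun z => 1 / (1 - l^* * phi z)) (1 - cmod l)^-1.
  apply: (H2le_lim (f := fun N z => psum (fun n => 1 * l^* ^+ n) (phi z) N)); last first.
    by move=> z hz; apply/cvC_geometric/cmodM_lt1; [exact: conj_disk|exact: h1].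
  move=> N; have [M' hM'] := H2le_poly_comp (fun n => 1 * l^* ^+ n) N hphi h1.
  apply: (H2le_bounded L0 hM') => z hz; apply: le_trans (cmod_sum _ _ _) _.
  apply: le_trans (_ : \sum_(i < N) cmod l ^+ i <= _); last first.
    by apply: geo_sum_le; rewrite cmod_ge0.
  apply: ler_sum => i _; rewrite mul1r cmodM !cmodX cmod_conj.
  by rewrite ler_piMr ?exprn_ge0 ?cmod_ge0 // exprn_ile1 ?cmod_ge0 ?h1.
have bnd z : disk z -> cmod (1 / (1 - l^* * phi z)) <= (1 - cmod l)^-1.
  move=> hz; rewrite mul1r cmodV.
  have n0 := den_neq0 hl (h1 _ hz).
  have h2 : cmod (l^* * phi z) <= cmod l.
    by rewrite cmodM cmod_conj ler_piMr ?cmod_ge0 ?h1.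
  have h3 := cmod_triB 1 (l^* * phi z); rewrite cmod1 in h3.
  by rewrite lef_pV2 ?posrE; lra.
have := H2le_mul L0 inv bnd (H2leB (H2le_cst l) hphi) => hm.
apply: (H2le_bounded ler01 (M' := (1 - cmod l)^-1 * (cmod l + M))).
  by apply: H2le_ext hm => z _; rewrite /moebius mul1r mulrC.
by move=> z hz; apply/ltW/moebius_disk => //; exact: h.
Qed.

Lemma H2le_id : H2le (fun z : C => z) 1.
Proof. exact: (H2le_monomial R 1). Qed.

(* With [l = phi p], [b = moebius l o phi], which vanishes at p, and
   [F = nker l * (f o moebius l)], the function is [(1 - l^* b) * nker p * (F o b)]. *)
Lemma H2le_weighted_comp phi p f M M' : disk p -> H2le phi M' ->
  (forall z, disk z -> disk (phi z)) -> H2le f M ->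
  H2le (fun z => cof (kdist (phi p)) * nker p z * f (phi z)) (2 * M).
Proof.
move=> hp hphi h hf; set l := phi p; have hl : disk l := h _ hp.
have hF : H2le (fun z => nker l z * f (moebius l z)) M.
  apply: (H2le_nker_comp (u := moebius l) (M' := 1) hl) hf; last exact: moebiusxx.
    exact: (H2le_moebius_comp hl H2le_id).
  by move=> z; exact: moebius_disk.
pose b z := moebius l (phi z).
have hb : H2le b 1 := H2le_moebius_comp hl hphi h.
have bd1 z : disk z -> disk (b z) by move=> hz; apply/moebius_disk/h.
have hG := H2le_nker_comp hp hb bd1 (moebiusxx l) hF.
have hm : H2le (fun z => 1 - l^* * b z) (cmod 1 + cmod l^* * 1).
  exact: H2leB (H2le_cst 1) (H2leZ _ hb).
(* The factor [1 - conj l * b] cancels the denominator of [nker l] at [b z]; its modulus is at most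
   2, whence the constant. *)
apply: (H2le_ext _ (H2le_mul _ hm _ hG)) => // [z hz|z hz].
  have n0 := den_neq0 hl (ltW (bd1 _ hz)).
  rewrite moebiusK //; last exact: h.
  by rewrite {2}/nker; field.
apply: le_trans (cmodD _ _) _; rewrite cmod1 cmodN.
have := cmodM_lt1 (conj_disk hl) (ltW (bd1 _ hz)); lra.
Qed.

End Kernels.

(** * Bounded and compact weighted composition operators *)

Section WeightedComposition.
Variable R : realType.
Local Notation C := (Cx R).
Variable phi : C -> C.
Hypothesis phiH2 : H2le phi 1.
Hypothesis phi_disk : forall z, disk z -> disk (phi z).
Implicit Types (a b c : nat -> C) (f g W : C -> C) (z p l : C) (M e : R).

Definition Tle W M := forall f m, H2le f m -> H2le (fun z => W z * f (phi z)) (M * m).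

Definition Tcpt W := forall f : nat -> C -> C, (forall k, H2le (f k) 1) ->
  exists (s : nat -> nat) g Mg, [/\ (forall k, (s k < s k.+1)%N), H2le g Mg &
    forall e : R, 0 < e -> exists K, forall k, (K <= k)%N ->
      H2le (fun z => W z * f (s k) (phi z) - g z) e].

Lemma H2le0 f : (forall z, disk z -> f z = 0) -> H2le f 0.
Proof.
by move=> h; exists (fun=> 0); split; [exact: l2le0|move=> z hz]; rewrite h //;
   apply: peval_cv; apply: cvC_ext (cvC_cst 0) => N; rewrite /psum big1 // => i _; rewrite mul0r.
Qed.

Lemma Tle_unit W M : 0 <= M ->
  (forall f, H2le f 1 -> H2le (fun z => W z * f (phi z)) M) -> Tle W M.
Proof.
move=> M0 h f m hf; have := H2le_ge0 hf; rewrite le_eqVlt => /predU1P[m0|m0].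
  (* A norm bound of zero makes [f] vanish on the disk; in the other case [f] is rescaled to the
     unit ball. *)
  rewrite -m0 mulr0; apply: H2le0 => z hz.
  suff -> : f (phi z) = 0 by rewrite mulr0.
  apply/cmod_eq0/eqP; rewrite eq_le cmod_ge0 andbT.
  by have := H2le_eval_le hf (phi_disk hz); rewrite -m0 mul0r.
have n0 : cof m != 0.
  by apply/eqP => /(congr1 (@cmod R)); rewrite cmod0 cmod_cof ?ltW // => h0; rewrite h0 ltxx in m0.
have := H2leZ (cof m)^-1 hf; rewrite cmodV cmod_cof ?ltW // mulVf ?gt_eqF // => /h/(H2leZ (cof m)).
rewrite cmod_cof ?ltW // mulrC; apply: H2le_ext => z _.
by rewrite mulrCA mulVKf.
Qed.

(** Norm convergence implies pointwise convergence on the disk, where limits are unique. *)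
Lemma H2le_approx_eq0 g h :
  (forall e : R, 0 < e -> exists K, forall k, (K <= k)%N -> H2le (fun z => h k z - g z) e) ->
  (forall z, disk z -> cvC (fun k : nat => h k z) 0) -> forall z, disk z -> g z = 0.
Proof.
move=> hg hh z hz; apply: cvC_uniq (hh z hz) => e e0.
have d0 : 0 < 1 - cmod z by rewrite subr_gt0.
have [K hK] := hg _ (mulr_gt0 (divr_gt0 e0 (ltr0Sn R 1)) d0).
exists K => k /hK/(H2le_eval_le)/(_ hz); rewrite mulfK ?gt_eqF //; lra.
Qed.

(** A compact operator turns weak convergence into norm convergence: the norm limit of a subsequence
    of images is also their pointwise limit, hence zero. *)
Lemma Tcpt_weak_null W (f : nat -> C -> C) e : Tcpt W -> (forall k, H2le (f k) 1) ->
  (forall z, disk z -> cvC (fun k : nat => f k z) 0) -> 0 < e ->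
  exists k, H2le (fun z => W z * f k (phi z)) e.
Proof.
move=> hW hf f0 e0; have [s [g [Mg [hs hg hc]]]] := hW f hf.
have g0 := H2le_approx_eq0 (h := fun k z => W z * f (s k) (phi z)) hc.
have [K hK] := hc _ e0; exists (s K); apply: H2le_ext (hK K (leqnn _)) => z hz.
rewrite g0 ?subr0 // => {}z {}hz; rewrite -(mulr0 (W z)).
apply: cvCZ; apply: (cvC_sub (u := fun k => f k (phi z)) (subseq_ge hs)).
by apply/f0/phi_disk.
Qed.

(** Otherwise some vectors of the unit ball, vanishing to higher and higher order, would have images
    that are not small, although they tend to zero pointwise. *)
Lemma Tcpt_tail_small W e : Tcpt W -> 0 < e ->
  exists N, forall a, l2le a 1 -> (forall n, (n < N)%N -> a n = 0) ->
    H2le (fun z => W z * peval a (phi z)) e.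
Proof.
move=> hW e0; apply: contrapT => /forallNP h.
have {}h N : exists a, [/\ l2le a 1, (forall n, (n < N)%N -> a n = 0) &
    ~ H2le (fun z => W z * peval a (phi z)) e].
  by have /existsNP[a /not_implyP[h1 /not_implyP[h2 h3]]] := h N; exists a.
have [A hA] := choice h.
have [|z hz|//|k hk] := @Tcpt_weak_null W (fun k => peval (A k)) e hW.
- by move=> k; apply: H2le_peval; case: (hA k).
- have d0 : 0 < 1 - cmod z by rewrite subr_gt0.
  move=> t t0; have hz' : 0 <= cmod z < 1 by rewrite cmod_ge0.
  have [N hN] := exprn_small hz' (mulr_gt0 t0 d0).
  exists N => n /hN hn; rewrite subr0.
  have [h1 h2 _] := hA n.
  apply: le_lt_trans (peval_tail_le (M := 1) (N := n) _ h2 hz) _.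
    by move=> i; exact: l2le_coef h1.
  by rewrite mul1r ltr_pdivrMr.
- by case: (hA k) => _ _; apply.
Qed.

Lemma l2le_tail_small c M e : l2le c M -> 0 < e ->
  exists N0, forall N, (N0 <= N)%N -> l2le (tail N c) e.
Proof.
move=> hc e0; have [/cvgrPdist_lt hH2 _] := l2le_in_H2 hc.
set S := series (fun n => cmod (c n) ^+ 2) in hH2.
have nd : nondecreasing_seq S.
  by apply: nondecreasing_series => n _ _; exact: sqr_ge0.
have le n := nondecreasing_cvgn_le nd (l2le_in_H2 hc).1 n.
have [N0 _ hN0] := hH2 _ (exprn_gt0 2 e0).
exists N0 => N N0N; split=> [|L]; first exact: ltW.
have SE n : S n = \sum_(i < n) cmod (c i) ^+ 2 by rewrite /S /series /= big_mkord.
have [LN|NL] := leqP L N.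
  rewrite big1 ?sqr_ge0 // => i _.
  by rewrite /tail (leq_trans (ltn_ord i) LN) cmod0 expr0n.
have := hN0 N N0N; have := le L; rewrite !SE -(subnKC (ltnW NL)) !big_split_ord /=.
rewrite [X in _ -> _ -> X + _ <= _]big1 ?add0r; last first.
  by move=> i _; rewrite /tail ltn_ord cmod0 expr0n.
rewrite (eq_bigr (fun i : 'I_(L - N) => cmod (tail N c (N + i)%N) ^+ 2)); last first.
  by move=> i _; rewrite /tail ltnNge leq_addr.
move=> h1 /ltW/(le_trans (ler_norm _)); lra.
Qed.

Lemma pevalD a b z M M' : l2le a M -> l2le b M' -> disk z ->
  peval (fun n => a n + b n) z = peval a z + peval b z.
Proof.
move=> ha hb hz; apply: peval_cv.
have := cvCD (l2le_cv_ps ha hz) (l2le_cv_ps hb hz).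
by apply: cvC_ext => N; rewrite psumD.
Qed.

Lemma head_tail N a n : head N a n + tail N a n = a n.
Proof. by rewrite /head /tail; case: ifP; rewrite ?addr0 ?add0r. Qed.

Lemma peval_head_tail N a z M : l2le a M -> disk z ->
  peval (head N a) z + peval (tail N a) z = peval a z.
Proof.
move=> ha hz; rewrite -(pevalD (l2le_head N ha) (l2le_tail N ha)) //.
by congr (peval _ _); apply/funext => n; rewrite head_tail.
Qed.

Lemma tailD N a b n : tail N (fun n => a n + b n) n = tail N a n + tail N b n.
Proof. by rewrite /tail; case: ifP; rewrite ?addr0. Qed.

(** The image of the unit ball is relatively compact, so its tails are uniformly small:
    counterexamples for every [N] would, along a subsequence, have images [d + c] with [d] small and
    [c] fixed, and the tails of [c] tend to zero. *)
Lemma Tcpt_image_tail_small W e : Tcpt W -> 0 < e ->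
  exists N, forall a b M, l2le a 1 -> l2le b M ->
    (forall z, disk z -> peval b z = W z * peval a (phi z)) -> l2le (tail N b) e.
Proof.
move=> hW e0; apply: contrapT => /forallNP h.
have {}h N : exists ab : (nat -> C) * (nat -> C), [/\ l2le ab.1 1, exists M, l2le ab.2 M,
    (forall z, disk z -> peval ab.2 z = W z * peval ab.1 (phi z)) &
    ~ l2le (tail N ab.2) e].
  have /existsNP[a /existsNP[b /existsNP[M]]] := h N.
  by move=> /not_implyP[h1 /not_implyP[h2 /not_implyP[h3 h4]]]; exists (a, b); split=> //; exists M.
have [AB hAB] := choice h.
have [|s [g [Mg [hs [c [hc ec]] hcv]]]] := hW (fun k => peval (AB k).1).
  by move=> k; apply: H2le_peval; case: (hAB k).
have e2 : 0 < e / 2 by lra.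
have [K hK] := hcv _ e2; have [N0 hN0] := l2le_tail_small hc e2.
pose k := maxn K N0; have [_ [M hM] h3 []] := hAB (s k).
have [d [bdd ed]] := hK k (leq_maxl _ _).
have -> : (AB (s k)).2 = fun n => d n + c n.
  apply: (peval_inj hM (l2leD bdd hc)) => z hz.
  by rewrite (pevalD bdd hc) // ed // ec // h3 // subrK.
have -> : e = e / 2 + e / 2 by lra.
have -> : tail (s k) (fun n => d n + c n) = fun n => tail (s k) d n + tail (s k) c n.
  by apply/funext => n; rewrite tailD.
apply: l2leD; first exact: l2le_tail.
by apply/hN0/(leq_trans (leq_maxr K N0))/(subseq_ge hs).
Qed.

Lemma nker_le l z : disk l -> disk z -> cmod (nker l z) <= kdist l / (1 - cmod z).
Proof.
move=> hl hz; rewrite cmodM cmodV cmod_cof ?sqrtr_ge0 //.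
have d0 := kdist_gt0 hl; have z1 : 0 < 1 - cmod z by rewrite subr_gt0.
rewrite ler_wpM2l ?(ltW d0) //.
have h : cmod (l^* * z) <= cmod z.
  by rewrite cmodM cmod_conj ler_piMl ?cmod_ge0 // ltW.
have := cmod_triB 1 (l^* * z); rewrite cmod1 => h1.
by rewrite lef_pV2 ?posrE; lra.
Qed.

(** The kernels at [phi p] tend weakly to zero as [kdist (phi p)] does, so their images are small in
    norm. Evaluating an image at [p] gives the bound, because [nker (phi p)] is [1 / kdist (phi p)]
    at [phi p]. *)
Lemma Tcpt_value_small W e : Tcpt W -> 0 < e ->
  exists2 d : R, 0 < d & forall p, disk p -> kdist (phi p) < d ->
    cmod (W p) * kdist p <= e * kdist (phi p).
Proof.
move=> hW e0; apply: contrapT => h.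
have {}h (k : nat) : exists p, [/\ disk p, kdist (phi p) < k.+1%:R^-1 &
    ~ (cmod (W p) * kdist p <= e * kdist (phi p))].
  apply: contrapT => /forallNP hp; apply: h; exists k.+1%:R^-1 => [|p h1 h2].
    by rewrite invr_gt0 ltr0n.
  by apply: contrapT => h3; exact: (hp p).
have [P hP] := choice h.
have hl k : disk (phi (P k)) by case: (hP k) => /phi_disk.
have [|z hz|//|k hk] := @Tcpt_weak_null W (fun k => nker (phi (P k))) e hW.
- by move=> k; apply: H2le_nker.
- have z1 : 0 < 1 - cmod z by rewrite subr_gt0.
  move=> t t0; have /cvgrPdist_lt/(_ _ (mulr_gt0 t0 z1))[N _ hN] := @cvg_harmonic R.
  exists N => k /hN; rewrite sub0r normrN ger0_norm ?invr_ge0 // subr0 => hk.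
  apply: le_lt_trans (nker_le (hl k) hz) _; rewrite ltr_pdivrMr //.
  by apply: lt_trans hk; case: (hP k).
have [h1 _ []] := hP k; have := H2le_eval hk h1; rewrite nker_diag //.
have d0 := kdist_gt0 (hl k).
rewrite cmodM cmod_cof; last by rewrite invr_ge0 ltW.
by rewrite -/(kdist _) mulrAC ler_pdivrMr.
Qed.

(** At [p = 0] the kernel is the constant 1, so the weight in [H2le_weighted_comp] is the constant
    [kdist (phi 0)], which can be divided out. *)
Lemma comp_bounded : exists2 K : R, 0 <= K &
  forall f, H2le f 1 -> H2le (fun z => f (phi z)) K.
Proof.
have h0 : disk (0 : C) by rewrite /disk /mkset cmod0.
have d0 := kdist_gt0 (phi_disk h0).
have n0 : cof (kdist (phi 0)) != 0.
  by apply/eqP => /(congr1 (@cmod R)); rewrite cmod0 cmod_cof ?ltW // => e; rewrite e ltxx in d0.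
exists ((kdist (phi 0))^-1 * 2) => [|f hf]; first by rewrite mulr_ge0 // invr_ge0 ltW.
have := H2leZ (cof (kdist (phi 0)))^-1 (H2le_weighted_comp h0 phiH2 phi_disk hf).
rewrite mulr1 cmodV cmod_cof ?ltW //; apply: H2le_ext => z hz.
rewrite !mulrA mulVf // mul1r /nker conjC0 mul0r subr0 divr1 /kdist cmod0 expr0n subr0.
by rewrite sqrtr1 mul1r.
Qed.

(** On [|z| <= 1/2] the product is at most [2 d] times [2 K], which bounds the norm of the dilated
    function [peval b (z / 2)]; undoing the dilation costs at most [2^N] on the first [N]
    coefficients. *)
Lemma l2le_head_small N b w h (d K M : R) : l2le b M -> H2le w d -> H2le h K ->
  (forall z, disk z -> peval b z = w z * h z) -> l2le (head N b) (2 ^+ N * (4 * K * d)).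
Proof.
move=> hb hw hh e; have d0 := H2le_ge0 hw; have K0 := H2le_ge0 hh.
have h2 : cmod (cof (2^-1 : R)) = 2^-1 by rewrite cmod_cof // invr_ge0.
have C0 : 0 <= 4 * K * d by rewrite !mulr_ge0.
have half z : disk z -> cmod (cof (2^-1 : R) * z) <= 2^-1.
  by move=> hz; rewrite cmodM h2 ler_piMr ?invr_ge0 // ltW.
pose b' n := b n * cof (2^-1 : R) ^+ n.
have hb' : l2le b' (4 * K * d).
  have [Q [hQ eQ]] := H2le_cst (cof (4 * K * d)); rewrite cmod_cof // in hQ.
  apply: (l2le_dominated (G := fun z => peval b (cof 2^-1 * z)) _ hQ) => z hz.
    have hz2 : disk (cof (2^-1 : R) * z).
      by apply: le_lt_trans (half _ hz) _; rewrite invf_lt1 ?ltr1n.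
    have := l2le_cv_ps hb hz2; apply: cvC_ext => n.
    by apply: eq_bigr => i _; rewrite /b' exprMn mulrA.
  have hz2 : disk (cof (2^-1 : R) * z).
    by apply: le_lt_trans (half _ hz) _; rewrite invf_lt1 ?ltr1n.
  rewrite eQ // e // cmod_cof // cmodM.
  have bnd f m : H2le f m -> cmod (f (cof 2^-1 * z)) <= 2 * m.
    move=> hf; apply: le_trans (H2le_eval_le hf hz2) _.
    have h3 := half _ hz; rewrite ler_pdivrMr ?subr_gt0 //.
    have := H2le_ge0 hf; nra.
  apply: le_trans (ler_pM (cmod_ge0 _) (cmod_ge0 _) (bnd _ _ hw) (bnd _ _ hh)) _.
  by rewrite le_eqVlt; apply/orP; left; apply/eqP; ring.
have := l2leZ (cof (2 ^+ N : R)) hb'; rewrite cmod_cof ?exprn_ge0 //.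
apply: l2le_cmod_le => n; rewrite /head; case: ifP => nN; last by rewrite cmod0 cmod_ge0.
rewrite /b' !cmodM cmodX h2 cmod_cof ?exprn_ge0 // mulrCA ler_peMr ?cmod_ge0 //.
by rewrite exprVn -ler_pdivrMr ?invr_gt0 ?exprn_gt0 // invrK mul1r ler_weXn2l ?ler1n // ltnW.
Qed.

Lemma sum_head_le N a L :
  \sum_(i < L) cmod (head N a i) ^+ 2 <= \sum_(i < N) cmod (a i) ^+ 2.
Proof.
have [LN|NL] := leqP L N.
  rewrite -(subnKC LN) [leRHS]big_split_ord /= -[leLHS]addr0 lerD //.
    by apply: ler_sum => i _; rewrite /head; case: ifP; rewrite // cmod0 expr0n sqr_ge0.
  by apply: sumr_ge0 => i _; exact: sqr_ge0.
rewrite -(subnKC (ltnW NL)) big_split_ord /= [X in _ + X]big1 ?addr0 => [|i _].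
  by apply: ler_sum => i _; rewrite /head ltn_ord.
by rewrite /head ltnNge leq_addr cmod0 expr0n.
Qed.

Lemma sum_tail_le N a M L : l2le a M ->
  \sum_(i < L) cmod (tail N a i) ^+ 2 <= M ^+ 2 - \sum_(i < N) cmod (a i) ^+ 2.
Proof.
move=> ha; have [LN|NL] := leqP L N.
  rewrite big1 ?subr_ge0 ?ha.2 // => i _.
  by rewrite /tail (leq_trans (ltn_ord i) LN) cmod0 expr0n.
have := ha.2 L; rewrite -(subnKC (ltnW NL)) !big_split_ord /=.
rewrite [X in _ -> X + _ <= _]big1 ?add0r => [|i _]; last first.
  by rewrite /tail ltn_ord cmod0 expr0n.
rewrite (eq_bigr (fun i : 'I_(L - N) => cmod (tail N a (N + i)%N) ^+ 2)); first by lra.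
by move=> i _; rewrite /tail ltnNge leq_addr.
Qed.

Lemma l2le_head_add_tail N b c (X Y Z : R) : l2le b X -> l2le c Y -> 0 <= Z ->
  X ^+ 2 + Y ^+ 2 <= Z ^+ 2 -> l2le (fun n => head N b n + tail N c n) Z.
Proof.
move=> hb hc Z0 h; split=> // L; apply: le_trans h.
apply: le_trans (lerD ((l2le_head N hb).2 L) ((l2le_tail N hc).2 L)).
rewrite -big_split; apply: ler_sum => i _ /=.
by rewrite /head /tail; case: ifP; rewrite cmod0 expr0n ?addr0 ?add0r.
Qed.

Definition wker p z : C := cof (kdist (phi p)) * nker p z.

Lemma H2le_wker p : disk p -> H2le (wker p) (kdist (phi p)).
Proof.
move=> hp; have := H2leZ (cof (kdist (phi p))) (H2le_nker hp).
by rewrite mulr1 cmod_cof // sqrtr_ge0.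
Qed.

Lemma Tle_wker p : disk p -> Tle (wker p) 2.
Proof. by move=> hp f m hf; exact: (H2le_weighted_comp hp phiH2 phi_disk hf). Qed.

(* [T_W] essentially acts between the first N coordinates, while [wker p] sends the first
   N coordinates to nearly 0 and has nearly no output there: the two operators are almost
   orthogonal, and the norm of their sum is almost the maximum of their norms. *)
Lemma Tle_add_wker W M e : Tcpt W -> Tle W M -> 2 <= M -> 0 < e ->
  exists2 d : R, 0 < d & forall p, disk p -> kdist (phi p) < d ->
    Tle (fun z => W z + wker p z) (M + e).
Proof.
move=> hC hB M2 e0; have e4 : 0 < e / 4 by lra.
have M0 : 0 <= M by lra.
have [N1 hN1] := Tcpt_image_tail_small hC e4; have [N2 hN2] := Tcpt_tail_small hC e4.
have [K K0 hK] := comp_bounded.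
pose N := maxn N1 N2.
(* [D] adds the constants of the two estimates [dp1] and [dp2], so that one smallness condition
   yields both; the last 1 keeps it positive. *)
pose D := 2 ^+ N * (4 * K) + N%:R + 1.
have X0 : 0 <= 2 ^+ N * (4 * K) :> R by rewrite !mulr_ge0 ?exprn_ge0.
have N0 : 0 <= N%:R :> R by [].
have D0 : 0 < D by rewrite /D; lra.
exists (e / 4 / D) => [|p hp]; first by rewrite divr_gt0.
rewrite ltr_pdivlMr // /D => hd4.
have dp0 := kdist_gt0 (phi_disk hp).
have dp1 : 2 ^+ N * (4 * K * kdist (phi p)) <= e / 4.
  have : 0 <= kdist (phi p) * N%:R by rewrite mulr_ge0 // ltW.
  by rewrite !mulrA in X0 hd4 *; lra.
have dp2 : N%:R * kdist (phi p) <= e / 4.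
  have : 0 <= kdist (phi p) * (2 ^+ N * (4 * K)) by rewrite mulr_ge0 // ltW.
  lra.
apply: Tle_unit => [|f [a [ha ea]]]; first lra.
pose m1 := Num.sqrt (\sum_(i < N) cmod (a i) ^+ 2).
pose m2 := Num.sqrt (1 - \sum_(i < N) cmod (a i) ^+ 2).
have ha1 : l2le (head N a) m1 by apply: l2le_sqrt => L; exact: sum_head_le.
have ha2 : l2le (tail N a) m2.
  by apply: l2le_sqrt => L; have := sum_tail_le N L ha; rewrite expr1n.
have m12 : m1 ^+ 2 + m2 ^+ 2 = 1.
  rewrite !sqr_sqrtr; first by lra.
    by rewrite subr_ge0; have := ha.2 N; rewrite expr1n.
  by apply: sumr_ge0 => i _; exact: sqr_ge0.
have [b1 [hb1 eb1]] := hB _ _ (H2le_peval ha1).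
have hb2 : H2le (fun z => W z * peval (tail N a) (phi z)) (e / 4).
  apply: hN2; first exact: l2le_tail.
  by move=> n nN; rewrite /tail (leq_trans nN) // leq_maxr.
have hc1 : H2le (fun z => wker p z * peval (head N a) (phi z)) (e / 4).
  apply: (H2le_le dp2).
  apply: (H2le_dominated N0 (Tle_wker hp (H2le_peval ha1)) (H2le_wker hp)) => z hz.
  rewrite cmodM mulrC ler_wpM2r ?cmod_ge0 // peval_head.
  apply: le_trans (cmod_sum _ _ _) _.
  apply: le_trans (_ : \sum_(i < N) 1 <= _); last by rewrite sumr_const card_ord.
  apply: ler_sum => i _; rewrite cmodM cmodX mulr_ile1 ?exprn_ge0 ?cmod_ge0 //.
    exact: l2le_coef ha.
  by rewrite exprn_ile1 ?cmod_ge0 // ltW // phi_disk.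
have [c2 [hc2 ec2]] := Tle_wker hp (H2le_peval ha2).
have tb1 : l2le (tail N b1) (e / 4).
  have := hN1 _ _ _ (l2le_head N ha) hb1 eb1; apply: l2le_cmod_le => n.
  rewrite /tail; case: ifP => [_|/negbT]; first by rewrite cmod0 cmod_ge0.
  by rewrite -leqNgt geq_max => /andP[]; rewrite leqNgt => /negPf ->.
have hc2' : l2le (head N c2) (e / 4).
  apply: (l2le_le dp1).
  exact: (l2le_head_small N hc2 (H2le_wker hp) (hK _ (H2le_peval (l2le_tail N ha))) ec2).
(* Disjoint ranges of coefficients add in squares: [M^2 m1^2 + 4 m2^2 <= M^2] because [2 <= M]. *)
have hmain : l2le (fun n => head N b1 n + tail N c2 n) M.
  apply: (l2le_head_add_tail _ hb1 hc2) => //.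
  have h4 : 2 ^+ 2 <= M ^+ 2 by rewrite ler_pXn2r ?nnegrE.
  rewrite !exprMn; have : 0 <= m1 ^+ 2 by exact: sqr_ge0.
  have : 0 <= m2 ^+ 2 by exact: sqr_ge0.
  nra.
(* Four errors remain: the tail of [b1], the head of [c2], [W] acting on the tail of [a], and
   [wker p] acting on its head. *)
have -> : M + e = M + e / 4 + e / 4 + e / 4 + e / 4 by lra.
have := H2leD (H2leD (H2leD (H2leD (H2le_peval hmain) (H2le_peval tb1)) (H2le_peval hc2')) hb2) hc1.
apply: H2le_ext => z hz.
rewrite (pevalD (l2le_head N hb1) (l2le_tail N hc2)) //.
have <- := ea _ (phi_disk hz); rewrite -(peval_head_tail N ha (phi_disk hz)).
have := peval_head_tail N hb1 hz; have := peval_head_tail N hc2 hz.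
rewrite eb1 // ec2 // => h1 h2.
move: (peval (head N b1) z) (peval (tail N b1) z) (peval (head N c2) z)
  (peval (tail N c2) z) (peval (head N a) (phi z)) (peval (tail N a) (phi z))
  (W z) (wker p z) h1 h2 => x1 x2 x3 x4 x5 x6 x7 x8 h1 h2.
by rewrite mulrDl !mulrDr -h1 -h2; ring.
Qed.

End WeightedComposition.

(** * Gliding hump construction of a non-compact bounded operator *)

Section GlidingHump.
Variable R : realType.
Local Notation C := (Cx R).
Variable phi : C -> C.
Hypothesis phiH2 : H2le phi 1.
Hypothesis phi_disk : forall z, disk z -> disk (phi z).
Hypothesis bounded_Cpt : forall (W : C -> C) (M M' : R),
  H2le W M' -> Tle phi W M -> Tcpt phi W.
Hypothesis kdist_small : forall d : R, 0 < d -> exists2 p, disk p & kdist (phi p) < d.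

(** By [bounded_Cpt] the operator of [W] is compact; both estimates then hold wherever
    [kdist (phi q)] is small enough, so one [q] serves. *)
Lemma hump_step (W : C -> C) (M M' d e : R) : H2le W M' -> Tle phi W M -> 2 <= M ->
  0 < d -> 0 < e -> exists q, [/\ disk q, kdist (phi q) < d,
    Tle phi (fun z => W z + wker phi q z) (M + e) &
    cmod (W q) * kdist q <= 8^-1 * kdist (phi q)].
Proof.
move=> hW hB M2 d0 e0; have hC := bounded_Cpt hW hB.
have [d1 d10 h1] := Tle_add_wker phiH2 phi_disk hC hB M2 e0.
have e8 : 0 < 8^-1 :> R by rewrite invr_gt0.
have [d2 d20 h2] := Tcpt_value_small phi_disk hC e8.
have [|q hq] := @kdist_small (Num.min d (Num.min d1 d2)); first by rewrite !lt_min d0 d10.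
rewrite !lt_min => /and3P[q0 q1 q2].
by exists q; split=> //; [exact: h1|exact: h2].
Qed.

Lemma gliding_hump : False.
Proof.
(* A state holds the current weight, the step count and the size allowed for the next
   [kdist (phi q)]. The norm bound [3 - 2^-j] starts at 2 and stays below 3. The invariants are
   premises, so that a choice function exists on all states. *)
pose ok (st : (C -> C) * nat * R) (q : C) :=
  let: (W, j, d) := st in
  (exists M', H2le W M') -> Tle phi W (3 - 2^-1 ^+ j) -> 0 < d ->
  [/\ disk q, kdist (phi q) < d,
    Tle phi (fun z => W z + wker phi q z) (3 - 2^-1 ^+ j.+1) &
    cmod (W q) * kdist q <= 8^-1 * kdist (phi q)].
have half_le1 j : 2^-1 ^+ j <= 1 :> R.
  by rewrite exprn_ile1 ?invr_ge0 // invf_le1 ?ler1n.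
have half_gt0 j : 0 < 2^-1 ^+ j :> R by rewrite exprn_gt0 // invr_gt0.
have halfS j : 2^-1 ^+ j = 2 * 2^-1 ^+ j.+1 :> R by rewrite exprS mulVKf // pnatr_eq0.
have hok st : exists q, ok st q.
  case: st => [[W j] d]; rewrite /ok.
  have [[[M' hW] [hB d0]]|h] := pselect ((exists M', H2le W M') /\
      Tle phi W (3 - 2^-1 ^+ j) /\ 0 < d); last first.
    (* Where the invariants fail the requirement is void, and 0 is a default. *)
    by exists 0 => h1 h2 h3; case: h.
  have M2 : 2 <= 3 - 2^-1 ^+ j :> R by have := half_le1 j; lra.
  have [q hq] := hump_step hW hB M2 d0 (half_gt0 j.+1).
  exists q => _ _ _; case: hq => h1 h2 h3 h4; split=> //.
  have <- : 3 - 2^-1 ^+ j + 2^-1 ^+ j.+1 = 3 - 2^-1 ^+ j.+1 :> R by have := halfS j; lra.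
  exact: h3.
have [F hF] := choice hok.
(* Dividing by 16 keeps the sum of all later kernel weights at norm at most
   [2 * D j / 16 = D j / 8]. *)
pose next (st : (C -> C) * nat * R) : (C -> C) * nat * R :=
  (fun z => st.1.1 z + wker phi (F st) z, st.1.2.+1, kdist (phi (F st)) / 16).
pose st j := iter j next (fun=> 0, 0%N, 1).
pose W j := (st j).1.1; pose d j := (st j).2; pose q j := F (st j).
pose D j := kdist (phi (q j)).
have stE j : st j = (W j, j, d j).
  rewrite /W /d; case E : (st j) => [[w i] x] /=; congr (_, _, _).
  have -> : i = (st j).1.2 by rewrite E.
  by rewrite {E}; elim: j => //= j IH; rewrite IH.
have WS j : W j.+1 = fun z => W j z + wker phi (q j) z by [].
have dS j : d j.+1 = D j / 16 by [].
have inv j : [/\ exists M', H2le (W j) M', Tle phi (W j) (3 - 2^-1 ^+ j) &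
    0 < d j <= 2^-1 ^+ j].
  elim: j => [|j [hW hB /andP[d0 dle]]].
    split; [by exists (cmod 0); exact: H2le_cst| |by rewrite expr0 ltr01 lexx].
    move=> f m hf; apply: (H2le_le (M := 0)).
      by rewrite expr0 mulr_ge0 ?(H2le_ge0 hf) //; lra.
    by apply: H2le0 => z _; rewrite /W /= mul0r.
  have := hF (st j); rewrite {1}stE => /(_ hW hB d0)[h1 h2 h3 h4].
  split=> //.
    have [M' hM'] := hW; exists (M' + D j); rewrite WS; apply: H2leD => //.
    exact: H2le_wker.
  rewrite dS; have D0 : 0 < D j := kdist_gt0 (phi_disk h1).
  have := halfS j; rewrite -/(q j) -/(D j) in h2; rewrite divr_gt0 //=; lra.
have qP j : [/\ disk (q j), D j < d j & cmod (W j (q j)) * kdist (q j) <= 8^-1 * D j].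
  have [hW hB /andP[d0 _]] := inv j.
  by have := hF (st j); rewrite {1}stE => /(_ hW hB d0)[].
have D0 j : 0 < D j by case: (qP j) => /phi_disk/kdist_gt0.
(* Telescoping: an increment has norm at most [D], and [D <= 2 d - 2 (D / 16)] because [D < d]. *)
have diff k i : H2le (fun z => W (k + i)%N z - W k z) (2 * d k - 2 * d (k + i)%N).
  elim: i => [|i IH]; first by rewrite addn0 subrr; apply: H2le0 => z _; rewrite subrr.
  rewrite addnS; have [h1 h2 _] := qP (k + i)%N.
  have := H2leD IH (H2le_wker phi h1); rewrite -/(D _) => h.
  apply: (H2le_le _ (H2le_ext _ h)); first by rewrite dS; have := D0 (k + i)%N; lra.
  by move=> z _; rewrite WS addrAC.
have W2 j : H2le (W j) 2.
  have := diff 0%N j; rewrite add0n => h; apply: (H2le_le _ (H2le_ext _ h)).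
    by rewrite /d /= -/(d j); have [_ _ /andP[]] := inv j; lra.
  by move=> z _; rewrite subr0.
(* The limit weight inherits the bound 3 on its operator and the distance [D j / 8] to each
   [W j.+1]. *)
have [s [w [hs hw wcv]]] := H2le_weak_compact W2.
have Bw : Tle phi w 3.
  move=> f m hf; apply: (H2le_lim (f := fun k z => W (s k) z * f (phi z))) => [k|z hz].
    have [_ hB _] := inv (s k); apply: H2le_le (hB _ _ hf).
    by rewrite ler_wpM2r ?(H2le_ge0 hf) //; have := half_gt0 (s k); lra.
  rewrite mulrC; have := cvCZ (f (phi z)) (wcv z hz).
  by apply: cvC_ext => k; rewrite mulrC.
have wdiff j : H2le (fun z => w z - W j.+1 z) (8^-1 * D j).
  have js k : (j.+1 <= s (k + j.+1))%N.
    by apply: leq_trans (subseq_ge hs _); rewrite leq_addl.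
  apply: (H2le_lim (f := fun k z => W (s (k + j.+1)%N) z - W j.+1 z)) => [k|z hz].
    rewrite -(subnKC (js k)); apply: H2le_le (diff _ _).
    have [_ _ /andP[h _]] := inv (j.+1 + (s (k + j.+1) - j.+1))%N.
    by rewrite dS; lra.
  apply: cvCB (cvC_cst _).
  apply: (cvC_sub (u := fun k => W (s k) z) (s := fun k => (k + j.+1)%N)) (wcv z hz).
  by move=> k; rewrite leq_addr.
have e8 : 0 < 8^-1 :> R by rewrite invr_gt0.
(* The operator of [w] is bounded, hence compact by assumption; its value estimate applies at [q j]
   once [D j < d j <= 2^-j < eta]. *)
have [eta eta0 heta] := Tcpt_value_small phi_disk (bounded_Cpt hw Bw) e8.
have half01 : 0 <= (2^-1 : R) < 1 by apply/andP; split; [rewrite invr_ge0|rewrite invf_lt1 ?ltr1n].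
have [j hj] := exprn_small half01 eta0.
have [h1 h2 h3] := qP j; have [_ _ /andP[_ dj]] := inv j.
have h4 : cmod (w (q j)) * kdist (q j) <= 8^-1 * D j.
  by apply: heta => //; have := hj _ (leqnn j); rewrite -/(D j); lra.
have h5 := H2le_eval (wdiff j) h1; rewrite -/(kdist _) in h5.
have k0 := kdist_gt0 h1.
have h6 : cmod (wker phi (q j) (q j)) * kdist (q j) = D j.
  rewrite cmodM nker_diag // !cmod_cof ?invr_ge0 ?sqrtr_ge0 //.
  by rewrite mulfVK // gt_eqF.
(* After multiplication by [kdist (q j)] the left side is [D j], whereas each of the three terms on
   the right is at most [D j / 8]. *)
have h7 : cmod (wker phi (q j) (q j)) <=
    cmod (w (q j)) + cmod (W j (q j)) + cmod (w (q j) - W j.+1 (q j)).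
  have -> : wker phi (q j) (q j) =
      w (q j) - W j (q j) - (w (q j) - W j.+1 (q j)) by rewrite WS; ring.
  apply: le_trans (cmodD _ _) _; rewrite cmodN lerD2r.
  by apply: le_trans (cmodD _ _) _; rewrite cmodN.
have := ler_wpM2r (ltW k0) h7; rewrite h6 !mulrDl; have := D0 j; lra.
Qed.

End GlidingHump.

(** * Passage between coefficient-based operator definitions and function bounds *)

Section Translation.
Variable R : realType.
Local Notation C := (Cx R).
Implicit Types (w : nat -> C) (phi : C -> C).

Lemma Tle_wcomp_bounded phi w (M : R) :
  Tle phi (peval w) M -> wcomp_bounded (peval w) phi.
Proof.
move=> h; exists M => a /in_H2_bd ha.
have [b [hb eb]] := h _ _ (H2le_peval ha); have [h1 h2] := l2le_in_H2 hb.
by exists b; split=> //; split.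
Qed.

Lemma wcomp_compact_Cpt phi w : wcomp_compact (peval w) phi ->
  (forall z, disk z -> disk (phi z)) -> Tcpt phi (peval w).
Proof.
move=> h hphi f /choice[A hA].
have [k|k|s [B [c [hs hB hc hcv]]]] := h A.
- by case: (l2le_in_H2 (hA k).1).
- by case: (l2le_in_H2 (hA k).1).
have bc := in_H2_bd hc.
exists s, (peval c), (H2norm c); split=> //; first exact: H2le_peval.
move=> e e0; move/cvgrPdist_lt: hcv => /(_ _ e0)[K _ hK].
exists K => k /hK; rewrite sub0r normrN => hk.
have [/in_H2_bd hBk eB] := hB k.
have bB : l2le (fun n => B k n - c n) e.
  have bBc := l2leD hBk (l2leZ (-1) bc).
  have /in_H2_bd : in_H2 (fun n => B k n - c n).
    apply: (l2le_in_H2 (l2le_cmod_le _ bBc)).1 => n.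
    by rewrite mulN1r.
  by apply: l2le_le; exact: le_trans (ler_norm _) (ltW hk).
exists (fun n => B k n - c n); split=> // z hz.
rewrite -(hA (s k)).2; last exact: hphi.
rewrite -eB //; apply: peval_cv.
have := cvCB (l2le_cv_ps hBk hz) (l2le_cv_ps bc hz); apply: cvC_ext => N.
by rewrite /psum -sumrB; apply: eq_bigr => i _; rewrite mulrBl.
Qed.

Lemma wcomp_compact_small phi w (r : R) : 0 <= r < 1 ->
  (forall z, disk z -> cmod (phi z) <= r) -> in_H2 w ->
  wcomp_bounded (peval w) phi -> wcomp_compact (peval w) phi.
Proof.
move=> hr phir hw [M hM] A hA1 hA2.
have phid z : disk z -> disk (phi z).
  by move=> /phir h; case/andP: hr => _; exact: le_lt_trans.
have hA k : l2le (A k) 1 by apply: l2le_le (hA2 k) (in_H2_bd (hA1 k)).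
have [s [a [hs ba hcv]]] := l2le_subseq hA.
have [c [[hc ec] _]] := hM _ (l2le_in_H2 ba).1.
have [B hB] := choice (fun k => hM _ (hA1 (s k))).
exists s, B, c; split=> // [k|]; first by case: (hB k).
apply/cvgrPdist_lt => e e0.
have bw := in_H2_bd hw; have w0 := l2le_ge0 bw.
(* This uniform accuracy on [|z| <= r], multiplied by the norm of [w], stays below [e]; adding 1
   covers a weight of norm zero. *)
have e1 : 0 < e / 2 / (H2norm w + 1) by rewrite divr_gt0 //; lra.
have [K hK] := hcv _ _ hr e1.
exists K => // k /= Kk; rewrite sub0r normrN.
have [[/in_H2_bd bB eB] _] := hB k; have bc := in_H2_bd hc.
have bd1 : l2le (fun n => B k n - c n) (e / 2 / (H2norm w + 1) * H2norm w).
  apply: (l2le_dominatedZ (ltW e1) (G := fun z => peval (B k) z - peval c z) _ bw).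
    move=> z hz; have := cvCB (l2le_cv_ps bB hz) (l2le_cv_ps bc hz); apply: cvC_ext => N.
    by rewrite /psum -sumrB; apply: eq_bigr => i _; rewrite mulrBl.
  move=> z hz; rewrite eB // ec // -mulrBr cmodM mulrC ler_wpM2r ?cmod_ge0 //.
  exact: hK (phir _ hz).
have [_ h] := l2le_in_H2 bd1; rewrite ger0_norm ?sqrtr_ge0 //.
apply: le_lt_trans h _; rewrite mulrAC ltr_pdivrMr; last by lra.
nra.
Qed.

End Translation.

(** * Existence of a bounded non-compact operator and the supremum of the symbol *)

Theorem theorem6p2 (R : realType) (phi : (Cx R) -> (Cx R)) :
  analytic_selfmap phi ->
  ((exists omega : nat -> (Cx R),
       in_H2 omega /\
       (wcomp_bounded (peval omega) phi /\ ~ wcomp_compact (peval omega) phi))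
   <-> sup_norm_disk phi = 1).
Proof.
move=> [phia phid]; rewrite /sup_norm_disk.
set E := [set cmod (phi z) | z in disk (R:=R)].
have d0 : disk (0 : Cx R) by rewrite /disk /mkset cmod0.
have E0 : E (cmod (phi 0)) by exists 0.
have ubE : ubound E 1 by move=> _ [z /phid/ltW h <-].
have hsE : has_sup E by split; [exists (cmod (phi 0))|exists 1].
have leE z : disk z -> cmod (phi z) <= sup E.
  by move=> hz; apply: sup_upper_bound => //; exists z.
have supE1 : sup E <= 1 by apply: ge_sup => //; exists (cmod (phi 0)).
split=> [[w [hw [wb wnc]]]|supE].
  (* A supremum below 1 confines [phi] to a smaller disk, where boundedness implies compactness. *)
  apply/eqP; rewrite eq_le supE1 leNgt; apply/negP => lt1; apply: wnc.
  apply: (wcomp_compact_small (r := sup E)) => //.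
  by rewrite lt1 andbT; apply: le_trans (leE 0 d0); exact: cmod_ge0.
have phiH2 : H2le phi 1 by apply: H2le_analytic => // z /phid/ltW.
(* If no weight worked, every bounded operator with weight in H^2 would be compact, which the
   gliding hump refutes. *)
apply: contrapT => none; apply: (@gliding_hump R phi) => //.
  move=> W M M' [a [ha ea]] hB.
  have hB' : Tle phi (peval a) M.
    by move=> f m hf; apply: H2le_ext (hB _ _ hf) => z hz; rewrite ea.
  have hC : Tcpt phi (peval a).
    apply: wcomp_compact_Cpt => //; apply: contrapT => hnc; apply: none.
    exists a; split; first by case: (l2le_in_H2 ha).
    by split=> //; exact: Tle_wcomp_bounded hB'.
  move=> f hf; have [s [g [Mg [h1 h2 h3]]]] := hC f hf.
  exists s, g, Mg; split=> // e /h3[K hK]; exists K => k /hK.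
  by apply: H2le_ext => z hz; rewrite ea.
(* From [|phi p| > 1 - d^2 / 2] and [|phi p| < 1] it follows that [1 - |phi p|^2 < d^2]. *)
move=> d dgt0; have e0 : 0 < d ^+ 2 / 2 by rewrite divr_gt0 // exprn_gt0.
have [_ [p hp <-]] := sup_adherent e0 hsE; rewrite supE => hlt.
exists p => //; rewrite -(ltr_pXn2r (n := 2)) ?nnegrE ?sqrtr_ge0 ?ltW // kdist_sq; last exact: phid.
have := cmod_ge0 (phi p); have : cmod (phi p) < 1 := phid _ hp; nra.
Qed.
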